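(* Let $k$ be a field and $S=k[T_1,\ldots,T_n]$ with $n\geq 3$. (a) If $R=S/I(\mathcal{P}_n)$, then the $k$-algebra $H^R$ is generated by $H^R_{1,2}$ and $H^R_{2,3}$. (b) If $R=S/I(\mathcal{C}_n)$, then the $k$-algebra $H^R$ is generated by $H^R_{1,2}$ and $H^R_{2,3}$ if and only if $n\not\equiv 1\pmod 3$. If $n\equiv 1\pmod 3$, then for any $0\neq z\in H^R_{\lceil \frac{2n}{3}\rceil,\,n}$ the $k$-algebra $H^R$ is generated by $H^R_{1,2}$, $H^R_{2,3}$, and $z$.
   Context: $S$ is standard graded. The edge ideal $I(\mathcal{G})\subseteq S$ of a graph $\mathcal{G}$ on vertices $\{1,\ldots,n\}$ is generated by the monomials $T_iT_j$ such that $\{i,j\}$ is an edge. $\mathcal{P}_n$ is the $n$-path, with edges $\{1,2\},\ldots,\{n-1,n\}$; $\mathcal{C}_n$ is the $n$-cycle, with edges $\{1,2\},\ldots,\{n-1,n\},\{n,1\}$. $H^R=H(K^R)\cong\operatorname{Tor}^S(R,k)$ is the Koszul homology algebra of $R$, where $K^R$ is the Koszul complex on the images of $T_1,\ldots,T_n$ in $R$, a DG algebra. $H^R$ is a bigraded graded-commutative $k$-algebra, and $H^R_{i,j}$ denotes its component of homological degree $i$ and internal degree $j$. *)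

(* Defs.v *)
From HB Require Import structures.
From mathcomp Require Import all_boot all_order all_algebra.
From mathcomp Require Import boolp mpoly ring.

Set Implicit Arguments.
Unset Strict Implicit.
Unset Printing Implicit Defensive.

Import GRing.Theory.
Local Open Scope ring_scope.
Local Open Scope quotient_scope.

(* Vertices are numbered from 0: the vertex "i" of the literature is the
   ordinal of value i - 1. *)
Definition path_graph (n : nat) : rel 'I_n :=
  fun i j => (i.+1 == j :> nat) || (j.+1 == i :> nat).

(* [ordS] is the successor modulo n; this is the n-cycle as soon as n >= 3. *)
Definition cycle_graph (n : nat) : rel 'I_n :=
  fun i j => (ordS i == j) || (ordS j == i).

Arguments path_graph : clear implicits.
Arguments cycle_graph : clear implicits.

Section EdgeRing.
Variables (k : fieldType) (n : nat) (G : rel 'I_n).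

Definition edge_ideal : {pred {mpoly k[n]}} := fun f =>
  `[< exists c : 'I_n -> 'I_n -> {mpoly k[n]},
        f = \sum_(i < n) \sum_(j < n | G i j) c i j * ('X_i * 'X_j) >].

Lemma edge_ideal_meval0 f : f \in edge_ideal -> f.@[fun=> 0] = 0.
Proof.
case/asboolP=> c ->; rewrite rmorph_sum big1 // => i _.
rewrite rmorph_sum big1 //= => j _.
by rewrite !mevalM !mevalXU !mulr0.
Qed.

Fact edge_ideal_idealr : idealr_closed edge_ideal.
Proof.
split.
- apply/asboolP; exists (fun _ _ => 0) => /=.
  by rewrite big1 // => i _; rewrite big1 // => j _; rewrite mul0r.
- apply/negP => /edge_ideal_meval0/eqP; by rewrite meval1 oner_eq0.
- move=> a _ _ /asboolP[c ->] /asboolP[d ->]; apply/asboolP.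
  exists (fun i j => a * c i j + d i j) => /=.
  rewrite mulr_sumr -big_split; apply: eq_bigr => i _ /=.
  rewrite mulr_sumr -big_split; apply: eq_bigr => j _ /=.
  by rewrite [RHS]mulrDl -mulrA.
Qed.
HB.instance Definition _ :=
  isIdealr.Build {mpoly k[n]} edge_ideal edge_ideal_idealr.

Definition edge_ring : Type := {ideal_quot edge_ideal}.
HB.instance Definition _ := GRing.ComNzRing.on edge_ring.

Definition edge_pi (p : {mpoly k[n]}) : edge_ring := \pi_({ideal_quot edge_ideal}) p.

Fact edge_pi_zmod_morphism : zmod_morphism edge_pi.
Proof. by move=> p q; rewrite /edge_pi rmorphB. Qed.
Fact edge_pi_monoid_morphism : monoid_morphism edge_pi.
Proof. by split=> [|p q]; rewrite /edge_pi ?rmorph1 ?rmorphM. Qed.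
HB.instance Definition _ := GRing.isZmodMorphism.Build
  {mpoly k[n]} edge_ring edge_pi edge_pi_zmod_morphism.
HB.instance Definition _ := GRing.isMonoidMorphism.Build
  {mpoly k[n]} edge_ring edge_pi edge_pi_monoid_morphism.

Lemma edge_pi_eq0 p : (edge_pi p == 0) = (p \in edge_ideal).
Proof.
by rewrite -[p in RHS]subr0 Quotient.idealrBE -(rmorph0 edge_pi).
Qed.

Lemma edge_pi_surj (r : edge_ring) : exists p, r = edge_pi p.
Proof.
by exists (repr (r : {ideal_quot edge_ideal})); rewrite /edge_pi reprK.
Qed.

Definition edge_ring_scale (c : k) (r : edge_ring) : edge_ring :=
  edge_pi c%:MP * r.

Fact edge_ring_scaleA a b r :
  edge_ring_scale a (edge_ring_scale b r) = edge_ring_scale (a * b) r.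
Proof. by rewrite /edge_ring_scale mulrA mpolyCM rmorphM. Qed.
Fact edge_ring_scale1 : left_id 1 edge_ring_scale.
Proof. by move=> r; rewrite /edge_ring_scale mpolyC1 rmorph1 mul1r. Qed.
Fact edge_ring_scaleDr : right_distributive edge_ring_scale +%R.
Proof. by move=> c r s; rewrite /edge_ring_scale mulrDr. Qed.
Fact edge_ring_scaleDl r : {morph edge_ring_scale^~ r : a b / a + b}.
Proof. by move=> a b; rewrite /edge_ring_scale mpolyCD rmorphD mulrDl. Qed.
HB.instance Definition _ := GRing.Zmodule_isLmodule.Build k edge_ring
  edge_ring_scaleA edge_ring_scale1 edge_ring_scaleDr edge_ring_scaleDl.

Fact edge_ring_scaleAl (c : k) (r s : edge_ring) : c *: (r * s) = (c *: r) * s.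
Proof. exact: mulrA. Qed.
HB.instance Definition _ :=
  GRing.Lmodule_isLalgebra.Build k edge_ring edge_ring_scaleAl.
HB.instance Definition _ := GRing.Lalgebra_isComAlgebra.Build k edge_ring.

Definition edge_ring_homog (d : nat) (r : edge_ring) : Prop :=
  exists2 p : {mpoly k[n]}, p \is d.-homog & r = edge_pi p.

End EdgeRing.

Section Koszul.
Variables (k : fieldType) (R : comAlgType k) (n : nat).
Implicit Types (A B C D : {set 'I_n}) (i j : 'I_n).

(* The number of inversions of the concatenation of B and C, each being listed
   increasingly: e_B * e_C = (-1) ^+ ninv B C *: e_(B :|: C) for disjoint B, C. *)
Definition ninv B C : nat := (\sum_(b in B) \sum_(c in C) (c < b))%N.

Lemma ninvUl B B' C : [disjoint B & B'] ->
  ninv (B :|: B') C = (ninv B C + ninv B' C)%N.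
Proof. by move=> dBB'; rewrite /ninv -bigU //=; apply: eq_bigl => b; rewrite inE. Qed.

Lemma ninvUr B C C' : [disjoint C & C'] ->
  ninv B (C :|: C') = (ninv B C + ninv B C')%N.
Proof.
move=> dCC'; rewrite /ninv -big_split; apply: eq_bigr => b _ /=.
by rewrite -bigU //=; apply: eq_bigl => c; rewrite inE.
Qed.

Lemma ninv0l C : ninv set0 C = 0%N. Proof. by rewrite /ninv big_set0. Qed.
Lemma ninv0r B : ninv B set0 = 0%N.
Proof. by rewrite /ninv big1 // => b _; rewrite big_set0. Qed.

Lemma ninv1D i B : i \notin B -> (ninv [set i] B + ninv B [set i])%N = #|B|.
Proof.
move=> iB; rewrite /ninv big_set1 -big_split -sum1_card; apply: eq_bigr => b bB /=.
by rewrite big_set1; case: ltngtP => // /val_inj eqbi; rewrite -eqbi bB in iB.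
Qed.

(* R (x) /\(k^n): x : koszul stands for \sum_A x A *: e_A, where e_A is the
   product of the e_i, i in A, taken in increasing order. *)
Definition koszul : Type := {ffun {set 'I_n} -> R}.
HB.instance Definition _ := GRing.Lmodule.on koszul.
Implicit Types (x y z : koszul).

Definition koszul_one : koszul := [ffun A => (A == set0)%:R].
Definition koszul_mul x y : koszul :=
  [ffun A : {set 'I_n} =>
    \sum_(B : {set 'I_n} | B \subset A)
       (-1) ^+ ninv B (A :\: B) * x B * y (A :\: B)].

Fact koszul_mulA : associative koszul_mul.
Proof.
move=> x y z; apply/ffunP => A; rewrite !ffunE.
under eq_bigr => B _ do rewrite ffunE mulr_sumr.
under [RHS]eq_bigr => D _ do rewrite ffunE mulr_sumr mulr_suml.
rewrite [RHS](exchange_big_dep (fun B : {set 'I_n} => B \subset A)) /=; last first.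
  by move=> D B DA BD; apply: subset_trans DA.
apply: eq_bigr => B BA.
rewrite (reindex_onto (fun D => D :\: B) (fun C => B :|: C)) /=; last first.
  move=> C; rewrite subsetD => /andP[_ dCB].
  by rewrite setDUl setDv set0U; apply/setDidPl.
have UD B' D' : B' \subset D' -> B' :|: (D' :\: B') = D'.
  by move=> BD'; rewrite -{1}(setIidPr BD') setID.
apply: eq_big => [D|D].
  apply/andP/andP => [[DBA /eqP defD]|[DA BD]].
    by rewrite -defD subsetUl subUset BA (subset_trans DBA) ?subsetDl.
  by rewrite UD // setSD.
case/andP=> DBA /eqP defD.
have BD : B \subset D by rewrite -defD subsetUl.
have DA : D \subset A.
  by rewrite -defD subUset BA (subset_trans DBA) ?subsetDl.
have eqA : A :\: B :\: (D :\: B) = A :\: D by rewrite setDDl UD.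
have eqAB : A :\: B = (D :\: B) :|: (A :\: D).
  apply/setP => a; rewrite !inE; move/subsetP/(_ a): BD; move/subsetP/(_ a): DA.
  by case: (a \in A) (a \in B) (a \in D) => [] [] [] //= H1 H2; rewrite ?H1 ?H2.
have dD : [disjoint D :\: B & A :\: D].
  rewrite disjoints_subset; apply/subsetP => a; rewrite !inE => /andP[_ ->].
  by [].
have dB : [disjoint B & D :\: B] by rewrite disjoints_subset setCD subsetUr.
have eqD : ninv D (A :\: D) = (ninv B (A :\: D) + ninv (D :\: B) (A :\: D))%N.
  by rewrite -ninvUl // UD.
rewrite eqA {1}eqAB ninvUr // eqD !exprD.
move: ((-1) ^+ _) ((-1) ^+ _) ((-1) ^+ _) => s1 s2 s3.
by ring.
Qed.

Fact koszul_mul1l : left_id koszul_one koszul_mul.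
Proof.
move=> x; apply/ffunP => A; rewrite !ffunE (bigD1 set0) ?sub0set //=.
rewrite setD0 ninv0l ffunE eqxx !mul1r big1 ?addr0 // => B /andP[_ /negPf B0].
by rewrite ffunE B0 mulr0 mul0r.
Qed.

Fact koszul_mul1r : right_id koszul_one koszul_mul.
Proof.
move=> x; apply/ffunP => A; rewrite !ffunE (bigD1 A) //=.
rewrite setDv ninv0r ffunE eqxx mul1r mulr1 big1 ?addr0 // => B.
case/andP=> BA neqBA; rewrite ffunE setD_eq0 [A \subset B]negbTE ?mulr0 //.
by apply: contra neqBA => AB; rewrite eqEsubset BA.
Qed.

Fact koszul_mulDl : left_distributive koszul_mul +%R.
Proof.
move=> x y z; apply/ffunP => A; rewrite !ffunE -big_split.
by apply: eq_bigr => B _ /=; rewrite ffunE mulrDr mulrDl.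
Qed.

Fact koszul_mulDr : right_distributive koszul_mul +%R.
Proof.
move=> x y z; apply/ffunP => A; rewrite !ffunE -big_split.
by apply: eq_bigr => B _ /=; rewrite ffunE mulrDr.
Qed.

Fact koszul_one_neq0 : koszul_one != 0.
Proof. by apply/eqP => /ffunP/(_ set0)/eqP; rewrite !ffunE eqxx oner_eq0. Qed.

HB.instance Definition _ := GRing.Zmodule_isNzRing.Build koszul
  koszul_mulA koszul_mul1l koszul_mul1r koszul_mulDl koszul_mulDr
  koszul_one_neq0.

Lemma koszulZE (c : k) x A : (c *: x) A = c *: x A.
Proof. exact: ffunE. Qed.

Lemma koszulDE x y A : (x + y) A = x A + y A.
Proof. exact: ffunE. Qed.

Lemma koszulNE x A : (- x) A = - x A.
Proof. exact: ffunE. Qed.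

Lemma koszul1E A : (1 : koszul) A = (A == set0)%:R.
Proof. exact: ffunE. Qed.

Lemma koszulME x y A :
  (x * y) A =
  \sum_(B : {set 'I_n} | B \subset A)
     (-1) ^+ ninv B (A :\: B) * x B * y (A :\: B).
Proof. exact: ffunE. Qed.

Fact koszul_scaleAl (c : k) x y : c *: (x * y) = (c *: x) * y.
Proof.
apply/ffunP => A; rewrite koszulZE !koszulME scaler_sumr.
by apply: eq_bigr => B _; rewrite koszulZE -scalerAr -scalerAl.
Qed.
HB.instance Definition _ := GRing.Lmodule_isLalgebra.Build k koszul koszul_scaleAl.

Fact koszul_scaleAr (c : k) x y : c *: (x * y) = x * (c *: y).
Proof.
apply/ffunP => A; rewrite koszulZE !koszulME scaler_sumr.
by apply: eq_bigr => B _; rewrite koszulZE -scalerAr.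
Qed.
HB.instance Definition _ := GRing.Lalgebra_isAlgebra.Build k koszul koszul_scaleAr.

Variable t : 'I_n -> R.

(* d e_B = \sum_(i in B) (-1) ^+ #{b in B | b < i} t_i e_(B :\ i), read off as
   coefficients. *)
Definition koszul_diff x : koszul :=
  [ffun A : {set 'I_n} =>
    \sum_(i < n | i \notin A) (-1) ^+ ninv [set i] A * t i * x (i |: A)].
Local Notation d := koszul_diff.

Lemma koszul_diffE x A :
  d x A = \sum_(i < n | i \notin A) (-1) ^+ ninv [set i] A * t i * x (i |: A).
Proof. exact: ffunE. Qed.

Fact koszul_diff_linear : linear d.
Proof.
move=> c x y; apply/ffunP => A; rewrite koszulDE koszulZE !koszul_diffE.
rewrite scaler_sumr -big_split; apply: eq_bigr => i _ /=.
by rewrite koszulDE koszulZE mulrDr scalerAr.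
Qed.
HB.instance Definition _ :=
  GRing.isLinear.Build k koszul koszul *:%R d koszul_diff_linear.

Lemma koszul_diffK x : d (d x) = 0.
Proof.
apply/ffunP => A; rewrite koszul_diffE [RHS]ffunE.
pose F i j := (-1) ^+ ninv [set i] A * t i *
  ((-1) ^+ ninv [set j] (i |: A) * t j * x (j |: (i |: A))).
under eq_bigr => i iA do rewrite koszul_diffE mulr_sumr.
pose P i j := (i \notin A) && (j \notin i |: A).
have PC i j : P i j = P j i.
  by rewrite /P !inE !negb_or (eq_sym i j); case: (i \in A); case: (j \in A); case: eqP.
have FC i j : P i j -> F i j = - F j i.
  rewrite /P !inE negb_or => /and3P[iA ji jA].
  rewrite /F setUCA ninvUr ?disjoints1 ?inE ?(eq_sym i j) //.
  rewrite [ninv _ (j |: A)]ninvUr ?disjoints1 ?inE //.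
  have -> : (-1) ^+ (ninv [set j] [set i] + ninv [set j] A) =
            - ((-1) ^+ ninv [set i] [set j] * (-1) ^+ ninv [set j] A) :> R.
    have : (ninv [set i] [set j] + ninv [set j] [set i])%N = 1%N.
      by rewrite ninv1D ?inE ?cards1 // eq_sym.
    rewrite exprD -mulNr => eq1; congr (_ * _).
    case: (ninv [set i] _) eq1 => [|[|m]] //.
      by rewrite add0n => ->; rewrite expr0 expr1.
    by rewrite add1n => -[->]; rewrite expr0 expr1 opprK.
  rewrite exprD; move: ((-1) ^+ _) ((-1) ^+ _) ((-1) ^+ _) (x _) (t i) (t j) => s1 s2 s3 u v w.
  by ring.
transitivity (\sum_(i < n) \sum_(j < n | P i j) F i j).
  by rewrite big_mkcond; apply: eq_bigr => i _; rewrite /P; case: ifP => iA;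
    rewrite ?big_pred0_eq //; under eq_bigl => j do rewrite /=.
have split3 : \sum_(i < n) \sum_(j < n | P i j) F i j =
   \sum_(i < n) \sum_(j < n | P i j && (i < j)%N) F i j
   + \sum_(i < n) \sum_(j < n | P i j && (j < i)%N) F i j.
  rewrite -big_split; apply: eq_bigr => i _ /=.
  rewrite (bigID (fun j : 'I_n => i < j)%N) /=; congr (_ + _).
  apply: eq_bigl => j; rewrite -leqNgt leq_eqVlt andb_orr.
  case: eqP => [/val_inj ->|]; last by rewrite andbF.
  by rewrite /P !inE eqxx /= !andbF.
rewrite split3 [X in _ + X](exchange_big_dep xpredT) //= -big_split big1 // => i _ /=.
rewrite addrC; apply/eqP; rewrite addr_eq0 -sumrN; apply/eqP.
apply: eq_big => [j|j /andP[Pji _]]; first by rewrite PC.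
by rewrite FC.
Qed.

Definition koszul_sgn x : koszul := [ffun A : {set 'I_n} => (-1) ^+ #|A| * x A].

Lemma koszul_sgnE x A : koszul_sgn x A = (-1) ^+ #|A| * x A.
Proof. exact: ffunE. Qed.

Lemma koszul_sgnK : involutive koszul_sgn.
Proof.
by move=> x; apply/ffunP => A; rewrite !koszul_sgnE mulrA -expr2 sqrr_sign mul1r.
Qed.

Lemma koszul_diff_sgn x : d (koszul_sgn x) = - koszul_sgn (d x).
Proof.
apply/ffunP => A; rewrite koszulNE koszul_sgnE !koszul_diffE mulr_sumr -sumrN.
apply: eq_bigr => i iA; rewrite koszul_sgnE cardsU1 iA exprS.
move: ((-1) ^+ _) ((-1) ^+ _) (x _) (t i) => s1 s2 u v.
by ring.
Qed.

Let ct i x : koszul :=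
  [ffun A : {set 'I_n} =>
     if i \in A then 0 else (-1) ^+ ninv [set i] A * x (i |: A)].

Let ctE i x A :
  ct i x A = if i \in A then 0 else (-1) ^+ ninv [set i] A * x (i |: A).
Proof. exact: ffunE. Qed.

Let diff_ct x A : d x A = \sum_(i < n) t i * ct i x A.
Proof.
rewrite koszul_diffE big_mkcond; apply: eq_bigr => i _.
by rewrite ctE; case: (i \in A); rewrite /= ?mulr0 // mulrCA mulrA.
Qed.

Let setU1D i B A : i \notin A -> (i |: A) :\: (i |: B) = A :\: B.
Proof.
move=> iA; apply/setP => j; rewrite !inE.
by case: eqP => [->|_] //=; rewrite (negPf iA) andbF.
Qed.

Let sum_mem i A (F : {set 'I_n} -> R) :
  \sum_(B : {set 'I_n} | (B \subset i |: A) && (i \in B)) F B =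
  \sum_(B : {set 'I_n} | (B \subset A) && (i \notin B)) F (i |: B).
Proof.
rewrite (reindex_onto (fun B => i |: B) (fun B => B :\ i)) /=; last first.
  by move=> B /andP[_ iB]; rewrite setD1K.
apply: eq_bigl => B; rewrite setU11 andbT.
have [iB|iB] := boolP (i \in B).
  rewrite andbF; apply/negP => /andP[_ /eqP eqB].
  by move: iB; rewrite -eqB !inE eqxx.
rewrite setU1K // eqxx !andbT; apply/subsetP/subsetP => sBA j jB.
  have := sBA j; rewrite !inE jB orbT => /(_ isT) /orP[/eqP eqji|//].
  by rewrite -eqji jB in iB.
by move: jB; rewrite !inE => /orP[->//|/sBA ->]; rewrite orbT.
Qed.

Let ctM i x y : ct i (x * y) = ct i x * y + koszul_sgn x * ct i y.
Proof.
apply/ffunP => A; rewrite ctE koszulDE !koszulME.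
have [iA|iA] := boolP (i \in A).
  rewrite (bigID (fun B : {set 'I_n} => i \in B)) /= big1 ?add0r; last first.
    by move=> B /andP[_ iB]; rewrite ctE iB mulr0 mul0r.
  rewrite [X in _ + X](bigID (fun B : {set 'I_n} => i \in B)) /=.
  rewrite [X in _ + (_ + X)]big1 ?addr0; last first.
    by move=> B /andP[_ iB]; rewrite ctE !inE iB iA mulr0.
  have eqA : i |: (A :\ i) = A by rewrite setD1K.
  rewrite -[in X in _ + X]eqA sum_mem eqA.
  have eqS B : (B \subset A :\ i) && (i \notin B) = (B \subset A) && (i \notin B).
    by rewrite subsetD1 -andbA andbb.
  under [X in _ + X]eq_bigl => B do rewrite eqS.
  rewrite -big_split big1 //= => B /andP[BA iB].
  have eqC : A :\: B = i |: (A :\: (i |: B)).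
    apply/setP => j; rewrite !inE; case: eqP => [->|] //=.
    by rewrite iB iA.
  have iC : i \notin A :\: (i |: B) by rewrite !inE eqxx.
  rewrite !ctE (negPf iB) (negPf iC) -eqC koszul_sgnE cardsU1 iB.
  rewrite ninvUl ?disjoints1 // {1}eqC ninvUr ?disjoints1 //.
  have := ninv1D iB; set C := A :\: _ => <-; rewrite !exprD expr1.
  move: (x _) (y _) => u v.
  have := sqrr_sign R (ninv [set i] C); have := sqrr_sign R (ninv [set i] B).
  rewrite !expr2.
  move: ((-1) ^+ _) ((-1) ^+ _) ((-1) ^+ _) ((-1) ^+ _) => s1 s2 s3 s4 H3 H4.
  by ring: H3 H4.
rewrite (bigID (fun B : {set 'I_n} => i \in B)) /= sum_mem mulrDr !mulr_sumr.
congr (_ + _).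
  rewrite [RHS](bigID (fun B : {set 'I_n} => i \in B)) /= [X in _ = X + _]big1 ?add0r.
    apply: eq_bigr => B /andP[BA iB].
    rewrite setU1D // ctE (negPf iB) ninvUl ?disjoints1 //.
    have -> : ninv [set i] A = (ninv [set i] B + ninv [set i] (A :\: B))%N.
      rewrite -ninvUr; last by rewrite disjoints_subset setCD subsetUr.
      by rewrite -{1}(setIidPr BA) setID.
    rewrite !exprD; have := sqrr_sign R (ninv [set i] (A :\: B)); rewrite expr2.
    move: (x _) (y _) => u v.
    move: ((-1) ^+ _) ((-1) ^+ _) ((-1) ^+ _) => s1 s2 s3 H.
    by ring: H.
  by move=> B /andP[BA iB]; rewrite ctE iB mulr0 mul0r.
apply: eq_big => [B|B /andP[BA iB]].
  rewrite -subsetD1 setU1K //.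
have BA' : B \subset A by move: BA; rewrite -{2}(setU1K iA) subsetD1 iB andbT.
have iC : i \notin A :\: B by rewrite !inE (negPf iA) andbF.
have eqC : (i |: A) :\: B = i |: (A :\: B).
  by apply/setP => j; rewrite !inE; case: eqP => [->|] //=; rewrite iB.
rewrite ctE (negPf iC) koszul_sgnE eqC ninvUr ?disjoints1 //.
have -> : ninv [set i] A = (ninv [set i] B + ninv [set i] (A :\: B))%N.
  rewrite -ninvUr; last by rewrite disjoints_subset setCD subsetUr.
  by rewrite -{1}(setIidPr BA') setID.
rewrite -(ninv1D iB) !exprD.
move: (x _) (y _) => u v.
move: ((-1) ^+ _) ((-1) ^+ _) ((-1) ^+ _) ((-1) ^+ _) => s1 s2 s3 s4.
by ring.
Qed.

Lemma koszul_leibniz x y : d (x * y) = d x * y + koszul_sgn x * d y.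
Proof.
apply/ffunP => A; rewrite diff_ct koszulDE.
under eq_bigr => i _ do rewrite ctM koszulDE mulrDr.
rewrite big_split; congr (_ + _); rewrite koszulME.
  under [RHS]eq_bigr => B _ do rewrite diff_ct mulr_sumr mulr_suml.
  rewrite exchange_big; apply: eq_bigr => i _ /=; rewrite koszulME mulr_sumr.
  by apply: eq_bigr => B _; rewrite mulrA (mulrCA (t i)).
under [RHS]eq_bigr => B _ do rewrite diff_ct mulr_sumr.
rewrite exchange_big; apply: eq_bigr => i _ /=; rewrite koszulME mulr_sumr.
by apply: eq_bigr => B _; rewrite (mulrCA (t i)).
Qed.

(* The cycles form a subalgebra, of which the boundaries are a two-sided ideal. *)
Definition koszul_cycles : {pred koszul} := fun x => d x == 0.

Fact koszul_cycles_subalg : subalg_closed koszul_cycles.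
Proof.
have diff1 : d 1 = 0.
  apply/ffunP => A; rewrite koszul_diffE [RHS]ffunE big1 // => i _.
  rewrite koszul1E; case: eqP => [/setP/(_ i)|]; last by rewrite mulr0.
  by rewrite setU11 inE.
split; rewrite ?unfold_in.
- by rewrite diff1.
- move=> c x y; rewrite !unfold_in linearP /= => /eqP-> /eqP->.
  by rewrite scaler0 addr0.
- move=> x y; rewrite !unfold_in koszul_leibniz => /eqP-> /eqP->.
  by rewrite mul0r mulr0 addr0.
Qed.
HB.instance Definition _ :=
  GRing.isSubalgClosed.Build k koszul koszul_cycles koszul_cycles_subalg.

Record koszul_cycle := KoszulCycle {
  koszul_cycle_val :> koszul;
  koszul_cycle_valP : koszul_cycle_val \in koszul_cycles }.
HB.instance Definition _ := [isSub for koszul_cycle_val].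
HB.instance Definition _ := [Choice of koszul_cycle by <:].
HB.instance Definition _ := [SubChoice_isSubAlgebra of koszul_cycle by <:].
Implicit Types (u v : koszul_cycle).

Lemma koszul_cycleE u : d (val u) = 0.
Proof. exact/eqP/(koszul_cycle_valP u). Qed.

Definition koszul_boundaries : {pred koszul_cycle} := fun u =>
  `[< exists x : koszul, val u = d x >].

Fact koszul_boundaries_zmod : zmod_closed koszul_boundaries.
Proof.
split=> [|u v /asboolP[x ux] /asboolP[y vy]]; apply/asboolP.
  by exists 0; rewrite [RHS]linear0 rmorph0.
by exists (x - y); rewrite [RHS]linearB /= -ux -vy.
Qed.
HB.instance Definition _ :=
  GRing.isZmodClosed.Build koszul_cycle koszul_boundaries koszul_boundaries_zmod.

Lemma koszul_boundariesMl u v :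
  v \in koszul_boundaries -> u * v \in koszul_boundaries.
Proof.
case/asboolP=> y vy; apply/asboolP; exists (koszul_sgn (val u) * y).
have -> : val (u * v) = val u * val v by [].
rewrite vy koszul_leibniz koszul_sgnK koszul_diff_sgn koszul_cycleE.
have -> : koszul_sgn 0 = 0 by apply/ffunP => A; rewrite !ffunE mulr0.
by rewrite oppr0 mul0r add0r.
Qed.

Lemma koszul_boundariesMr u v :
  v \in koszul_boundaries -> v * u \in koszul_boundaries.
Proof.
case/asboolP=> y vy; apply/asboolP; exists (y * val u).
have -> : val (v * u) = val v * val u by [].
by rewrite vy koszul_leibniz koszul_cycleE mulr0 addr0.
Qed.

End Koszul.

Arguments koszul_boundaries {k R n} t _.

Section KoszulHomology.
Variables (k : fieldType) (n : nat) (G : rel 'I_n).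

Definition edge_gens (i : 'I_n) : edge_ring k G := edge_pi G 'X_i.
Local Notation B := (koszul_boundaries edge_gens).

Definition koszul_homology : Type := Quotient.quot B.
HB.instance Definition _ := GRing.Zmodule.on koszul_homology.

Definition homology_class (z : koszul_cycle edge_gens) : koszul_homology :=
  \pi_(Quotient.quot B) z.
Local Notation cls := homology_class.
Definition homology_repr (h : koszul_homology) : koszul_cycle edge_gens :=
  repr (h : Quotient.quot B).
Local Notation rep := homology_repr.

Lemma homology_reprK : cancel rep cls.
Proof. exact: (@reprK _ (Quotient.quot B)). Qed.

Fact homology_class_zmod_morphism : zmod_morphism cls.
Proof. by move=> z w; rewrite /cls raddfB. Qed.
HB.instance Definition _ := GRing.isZmodMorphism.Build
  (koszul_cycle edge_gens) koszul_homology cls homology_class_zmod_morphism.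

Lemma homology_class_eq0 z : (cls z == 0) = (z \in B).
Proof. by rewrite -[z in RHS]subr0 Quotient.idealrBE -(raddf0 cls). Qed.

Lemma homology_class_eq z w : cls z = cls w <-> z - w \in B.
Proof.
rewrite -homology_class_eq0 raddfB subr_eq0 /=.
by split=> [->|/eqP]; rewrite ?eqxx.
Qed.

Definition homology_one : koszul_homology := cls 1.
Definition homology_mul (g h : koszul_homology) : koszul_homology :=
  cls (rep g * rep h).
Definition homology_scale (c : k) (h : koszul_homology) : koszul_homology :=
  cls (c *: rep h).

Let cls_mul z w : homology_mul (cls z) (cls w) = cls (z * w).
Proof.
apply/homology_class_eq.
set z' := rep (cls z); set w' := rep (cls w).
have Bz : z' - z \in B by apply/homology_class_eq; rewrite homology_reprK.
have Bw : w' - w \in B by apply/homology_class_eq; rewrite homology_reprK.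
have -> : z' * w' - z * w = (z' - z) * w' + z * (w' - w).
  by rewrite mulrBl mulrBr addrA subrK.
by apply: rpredD; [apply: koszul_boundariesMr | apply: koszul_boundariesMl].
Qed.

Let cls_scale c z : homology_scale c (cls z) = cls (c *: z).
Proof.
apply/homology_class_eq; rewrite -scalerBr -[_ - _]mul1r scalerAl.
by rewrite koszul_boundariesMl //; apply/homology_class_eq; rewrite homology_reprK.
Qed.

Fact homology_mulA : associative homology_mul.
Proof.
move=> f g h; rewrite -[f]homology_reprK -[g]homology_reprK -[h]homology_reprK.
by rewrite !cls_mul mulrA.
Qed.
Fact homology_mul1l : left_id homology_one homology_mul.
Proof. by move=> h; rewrite -[h]homology_reprK cls_mul mul1r. Qed.
Fact homology_mul1r : right_id homology_one homology_mul.
Proof. by move=> h; rewrite -[h]homology_reprK cls_mul mulr1. Qed.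
Fact homology_mulDl : left_distributive homology_mul +%R.
Proof.
move=> f g h; rewrite -[f]homology_reprK -[g]homology_reprK -[h]homology_reprK.
by rewrite -raddfD !cls_mul -raddfD mulrDl.
Qed.
Fact homology_mulDr : right_distributive homology_mul +%R.
Proof.
move=> f g h; rewrite -[f]homology_reprK -[g]homology_reprK -[h]homology_reprK.
by rewrite -raddfD !cls_mul -raddfD mulrDr.
Qed.

Fact homology_one_neq0 : homology_one != 0.
Proof.
rewrite homology_class_eq0; apply/asboolP => -[x /ffunP/(_ set0)].
rewrite rmorph1 koszul1E eqxx koszul_diffE.
have lift i : {p : {mpoly k[n]} | x (i |: set0) = edge_pi G p}.
  by apply/cid; have [p ->] := edge_pi_surj (x (i |: set0)); exists p.
under eq_bigr => i _ do
  rewrite ninv0r expr0 mul1r (svalP (lift i)) -rmorphM.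
rewrite -(rmorph1 (edge_pi G)) -rmorph_sum => /eqP.
rewrite -subr_eq0 -rmorphB edge_pi_eq0 => /edge_ideal_meval0/eqP.
rewrite rmorphB rmorph1 rmorph_sum big1 ?subr0 ?oner_eq0 // => i _ /=.
by rewrite mevalM mevalXU mul0r.
Qed.
HB.instance Definition _ := GRing.Zmodule_isNzRing.Build koszul_homology
  homology_mulA homology_mul1l homology_mul1r homology_mulDl homology_mulDr
  homology_one_neq0.

Fact homology_class_monoid_morphism : monoid_morphism cls.
Proof. by split=> // z w; rewrite -cls_mul. Qed.
HB.instance Definition _ := GRing.isMonoidMorphism.Build
  (koszul_cycle edge_gens) koszul_homology cls homology_class_monoid_morphism.

Fact homology_scaleA a b h :
  homology_scale a (homology_scale b h) = homology_scale (a * b) h.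
Proof. by rewrite -[h]homology_reprK !cls_scale scalerA. Qed.
Fact homology_scale1 : left_id 1 homology_scale.
Proof. by move=> h; rewrite -[h]homology_reprK cls_scale scale1r. Qed.
Fact homology_scaleDr : right_distributive homology_scale +%R.
Proof.
move=> c g h; rewrite -[g]homology_reprK -[h]homology_reprK.
by rewrite -raddfD !cls_scale scalerDr raddfD.
Qed.
Fact homology_scaleDl h : {morph homology_scale^~ h : a b / a + b}.
Proof.
by move=> a b; rewrite -[h]homology_reprK !cls_scale scalerDl raddfD.
Qed.
HB.instance Definition _ := GRing.Zmodule_isLmodule.Build k koszul_homology
  homology_scaleA homology_scale1 homology_scaleDr homology_scaleDl.

Fact homology_class_scalable : scalable cls.
Proof. by move=> c z; rewrite -cls_scale. Qed.
HB.instance Definition _ := GRing.isScalable.Build k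
  (koszul_cycle edge_gens) koszul_homology *:%R cls homology_class_scalable.

Fact homology_scaleAl (c : k) (g h : koszul_homology) :
  c *: (g * h) = (c *: g) * h.
Proof.
rewrite -[g]homology_reprK -[h]homology_reprK.
by rewrite -rmorphM -!linearZ -rmorphM scalerAl.
Qed.
HB.instance Definition _ :=
  GRing.Lmodule_isLalgebra.Build k koszul_homology homology_scaleAl.

Fact homology_scaleAr (c : k) (g h : koszul_homology) :
  c *: (g * h) = g * (c *: h).
Proof.
rewrite -[g]homology_reprK -[h]homology_reprK.
by rewrite -rmorphM -!linearZ -rmorphM scalerAr.
Qed.
HB.instance Definition _ :=
  GRing.Lalgebra_isAlgebra.Build k koszul_homology homology_scaleAr.

(* The component of homological degree i and internal degree j of the Koszul
   complex: each e_a has bidegree (1, 1). *)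
Definition koszul_bidegree (i j : nat) (x : koszul (edge_ring k G) n) : Prop :=
  forall A : {set 'I_n}, x A != 0 ->
    #|A| = i /\ exists2 d, (d + i)%N = j & edge_ring_homog d (x A).

Definition homology_bidegree (i j : nat) (h : koszul_homology) : Prop :=
  exists2 z : koszul_cycle edge_gens, koszul_bidegree i j z & h = cls z.

End KoszulHomology.

(* The only unital k-subalgebra of A that contains X is A itself. *)
Definition generates_algebra (k : fieldType) (A : lalgType k) (X : A -> Prop) :
    Prop :=
  forall P : {pred A}, subalg_closed P -> (forall x, X x -> x \in P) ->
    forall x, x \in P.

(* The ceiling of m / d, for d > 0. *)
Definition ceil_divn (m d : nat) : nat := ((m + d.-1) %/ d)%N.

(* Main.v *)
From HB Require Import structures.
Require Import Defs.
From mathcomp Require Import all_boot all_order all_algebra.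
From mathcomp Require Import boolp mpoly ring zify.

(** The Koszul complex [K] is graded by multidegrees [u] in N^n, each [T_i] and
    [e_i] having degree the i-th unit vector, and it suffices to study
    multihomogeneous cycles.  A cycle whose multidegree [u] has an entry larger
    than 1, or an isolated vertex in the graph induced on its support, is a
    boundary.  If the support contains a leaf [a] with neighbour [b] and next
    neighbour [c], every cycle is homologous to [e_a T_b h], and even to
    [(e_a T_b e_c) h] with [h] a cycle of smaller support.  As [e_a T_b] and
    [e_a T_b e_c] have bidegrees (1, 2) and (2, 3), this settles the path, and
    for the cycle graph all multidegrees but (1, ..., 1).

    There, fix a vertex [v] with neighbours [f], [l]: a cycle is [e_v y + T_v z]
    with [y] a cycle on a path of n - 1 vertices, so [y] is homologous to a
    multiple of one explicit product [w], while cycles [T_v z] have the form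
    [(T_v e_f e_l) h].  If n = 2 mod 3 then [w = 0]; if n = 0 mod 3 then [e_v w]
    is again a product of cycles of bidegree (2, 3); if n = 1 mod 3 every cycle
    [T_v z] is a boundary, so the homology is a line, and [e_v w] extends to a
    cycle which is not a boundary.  Its bidegree (i, j) has 3 i > 2 j, whereas
    the generators satisfy 3 i <= 2 j. *)

Set Implicit Arguments.
Unset Strict Implicit.
Unset Printing Implicit Defensive.

Import GRing.Theory.
Local Open Scope ring_scope.

(** * Monomials in an edge ring *)

Lemma lepm_addr n (m m' : 'X_{1..n}) : (m <= m + m')%MM.
Proof. by apply/mnm_lepP => i; rewrite mnmDE leq_addr. Qed.

Lemma addmCA n : left_commutative (@mnm_add n).
Proof. by move=> m1 m2 m3; rewrite !addmA [(m1 + _)%MM]addmC. Qed.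

Lemma mnm_split n (u : 'X_{1..n}) a : u a != 0%N -> u = (U_(a) + (u - U_(a)))%MM.
Proof.
move=> ua; rewrite addmC submK //; apply/mnm_lepP => i; rewrite mnm1E.
by case: eqP => // <-; rewrite lt0n.
Qed.

Section EdgeRingMonomials.
Variables (k : fieldType) (n : nat) (G : rel 'I_n).
Local Notation R := (edge_ring k G).
Implicit Types (m u : 'X_{1..n}) (r : R) (a b i j : 'I_n).

Definition emon m : R := edge_pi G 'X_[m].

(** The standard monomials of the edge ideal: by [emon_eq0], exactly those that survive in [R]. *)
Definition indep m : bool :=
  [forall i, forall j, G i j ==> ~~ (U_(i) + U_(j) <= m)%MM].

Definition nonadjacent a u : Prop := forall i, u i != 0%N -> ~~ G a i.

Lemma edge_piZ (c : k) p : edge_pi G (c *: p) = c *: edge_pi G p.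
Proof. by rewrite -mul_mpolyC rmorphM. Qed.

Lemma edge_ideal_coeff0 p m : p \in @edge_ideal k n G -> indep m -> p@_m = 0.
Proof.
case/asboolP=> c -> im; rewrite raddf_sum big1 // => i _.
rewrite raddf_sum big1 //= => j Gij.
rewrite -mpolyXD; apply/eqP; rewrite mcoeff_eq0; apply/negP.
rewrite (perm_mem (msuppMX _ _)) => /mapP[m' _ def_m].
move/forallP/(_ i)/forallP/(_ j)/implyP/(_ Gij)/negP: im; apply.
by rewrite def_m lepm_addr.
Qed.

Lemma emon_eq0 m : (emon m == 0) = ~~ indep m.
Proof.
rewrite edge_pi_eq0; apply/idP/idP => [Im|].
  apply/negP => /(edge_ideal_coeff0 Im)/eqP.
  by rewrite mcoeffX eqxx oner_eq0.
case/forallPn => i /forallPn[j]; rewrite negb_imply negbK => /andP[Gij le_m].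
rewrite -(submK le_m) mpolyXD; apply/asboolP.
exists (fun i' j' => ((i' == i) && (j' == j))%:R * 'X_[m - (U_(i) + U_(j))]).
rewrite (bigD1 i) //= (bigD1 j) //= !eqxx mul1r mpolyXD.
rewrite big1 ?addr0; last by move=> j' /andP[_ /negPf->]; rewrite mul0r mul0r.
rewrite big1 ?addr0 // => i' /negPf ni'; rewrite big1 // => j' _.
by rewrite ni' !mul0r.
Qed.

Lemma emonD m1 m2 : emon (m1 + m2) = emon m1 * emon m2.
Proof. by rewrite /emon mpolyXD rmorphM. Qed.

Lemma edge_gensE a : edge_gens k G a = emon U_(a). Proof. by []. Qed.

Lemma edge_gens_edge a b : G a b -> edge_gens k G a * edge_gens k G b = 0.
Proof.
move=> Gab; apply/eqP; rewrite !edge_gensE -emonD emon_eq0.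
apply/negP => /forallP/(_ a)/forallP/(_ b)/implyP/(_ Gab).
by rewrite lepm_refl.
Qed.

(** The component along [emon m] is an element of [R] rather than a scalar: the coefficient of a
    lift is well defined only for independent [m], and for all other [m] the factor [emon m] is
    0. *)
Definition edge_coeff m r : R :=
  (sval (cid (edge_pi_surj r)))@_m *: emon m.

Lemma edge_coeff_pi m p : edge_coeff m (edge_pi G p) = p@_m *: emon m.
Proof.
rewrite /edge_coeff; case: cid => q /= eq_pq.
have Iqp : q - p \in @edge_ideal k n G.
  by rewrite -edge_pi_eq0 rmorphB /= eq_pq subrr.
have [im|] := boolP (indep m); last first.
  by rewrite -emon_eq0 => /eqP->; rewrite !scaler0.
congr (_ *: _); apply/eqP; rewrite -subr_eq0 -mcoeffB.
by rewrite (edge_ideal_coeff0 Iqp).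
Qed.

Lemma edge_coeff_is_linear m : linear (edge_coeff m).
Proof.
move=> c r s; have [p ->] := edge_pi_surj r; have [q ->] := edge_pi_surj s.
rewrite -edge_piZ -rmorphD !edge_coeff_pi mcoeffD mcoeffZ scalerDl scalerA.
by [].
Qed.
HB.instance Definition _ m :=
  GRing.isLinear.Build k R R *:%R (edge_coeff m) (edge_coeff_is_linear m).

Lemma edge_coeff_emon m m' : edge_coeff m (emon m') = (m' == m)%:R *: emon m'.
Proof. by rewrite edge_coeff_pi mcoeffX; case: eqP => [->|]; rewrite ?scale0r. Qed.

Lemma edge_ring_sum r :
  exists s : seq 'X_{1..n}, exists c, r = \sum_(m <- s) c m *: emon m.
Proof.
have [p ->] := edge_pi_surj r; exists (msupp p), (fun m => p@_m).
rewrite {1}[p]mpolyE raddf_sum; apply: eq_bigr => m _ /=.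
exact: edge_piZ.
Qed.

(** T_a kills a nonzero monomial only by completing an edge at [a]. If [a] already occurs in it, or
    none of its variables is a neighbour of [a], no new edge arises. *)
Lemma emon_cancel a m (c : k) : irreflexive G -> ssrbool.symmetric G ->
  m a != 0%N \/ nonadjacent a m ->
  edge_gens k G a * (c *: emon m) = 0 -> c *: emon m = 0.
Proof.
move=> Girr Gsym am; rewrite -scalerAr edge_gensE -emonD => /eqP; rewrite scaler_eq0.
case/predU1P => [->|]; first by rewrite scale0r.
rewrite emon_eq0 => nim; apply/eqP; rewrite scaler_eq0 emon_eq0.
apply/orP; right; apply: contra nim => im.
have neG i j : G i j -> i != j by apply: contraTneq => ->; rewrite Girr.
have iE i j : G i j -> (m i == 0%N) || (m j == 0%N).
  move=> Gij; move/forallP/(_ i)/forallP/(_ j)/implyP/(_ Gij): im.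
  apply: contraR; rewrite negb_or -!lt0n => /andP[mi mj].
  apply/mnm_lepP => l; rewrite mnmDE !mnm1E.
  case: (eqVneq i l) => [<-|_]; first by rewrite eq_sym (negPf (neG _ _ Gij)).
  by case: eqP => [<-|].
have m_a i : G a i -> m i = 0%N.
  move=> Gai; case: am (iE _ _ Gai) => [/negPf->/= /eqP //|sep _].
  by apply/eqP; apply: contraLR Gai; apply: sep.
apply/forallP => i; apply/forallP => j; apply/implyP => Gij.
apply/mnm_lepP => le_ij; have := le_ij i; have := le_ij j.
rewrite !mnmDE !mnm1E !eqxx ![_ == i]eq_sym.
rewrite (negPf (neG _ _ Gij)) /= addn0 add0n.
case: (eqVneq i a) Gij => [->|_] Gij.
  by rewrite (m_a _ Gij) (negPf (neG _ _ Gij)).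
case: (eqVneq j a) Gij => [->|_] Gij.
  by rewrite Gsym in Gij; rewrite (m_a _ Gij).
by case/orP: (iE _ _ Gij) => /eqP->.
Qed.

End EdgeRingMonomials.

(** * Multiplication by the generators of the Koszul complex *)

Section KoszulOperators.
Variables (k : fieldType) (R : comAlgType k) (n : nat) (t : 'I_n -> R).
Local Notation K := (koszul R n).
Local Notation d := (koszul_diff t).
Implicit Types (x y : K) (A B : {set 'I_n}) (a b i : 'I_n).

Definition kgen a : K := [ffun B => (B == [set a])%:R].

Definition kmulg a x : K := kgen a * x.

(** The scalars of [K] are those of [k], so the action of [t a] is defined coefficientwise. *)
Definition kmulv a x : K := [ffun A => t a * x A].

Local Notation E := kmulg.
Local Notation T := kmulv.

Lemma kmulgE a x A :
  E a x A = if a \in A then (-1) ^+ ninv [set a] (A :\ a) * x (A :\ a) else 0.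
Proof.
rewrite /E koszulME; case: ifPn => aA.
  rewrite (bigD1 [set a]) ?sub1set //= big1 ?addr0 => [|B /andP[_ /negPf Ba]].
    by rewrite ffunE eqxx mulr1.
  by rewrite ffunE Ba mulr0 mul0r.
rewrite big1 // => B BA; rewrite ffunE; case: eqP BA => [->|_ _].
  by rewrite sub1set (negPf aA).
by rewrite mulr0 mul0r.
Qed.

Lemma kmulvE a x A : T a x A = t a * x A. Proof. exact: ffunE. Qed.

Lemma kmulg_is_linear a : linear (E a).
Proof. by move=> c x y; rewrite /E mulrDr scalerAr. Qed.
HB.instance Definition _ a :=
  GRing.isLinear.Build k K K *:%R (E a) (kmulg_is_linear a).

Lemma kmulv_is_linear a : linear (T a).
Proof.
move=> c x y; apply/ffunP => A.
by rewrite !(kmulvE, koszulDE, koszulZE) mulrDr scalerAr.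
Qed.
HB.instance Definition _ a :=
  GRing.isLinear.Build k K K *:%R (T a) (kmulv_is_linear a).

Lemma kmulgM a x y : E a (x * y) = E a x * y.
Proof. exact: mulrA. Qed.

Lemma kmulvM a x y : T a (x * y) = T a x * y.
Proof.
apply/ffunP => A; rewrite kmulvE !koszulME mulr_sumr; apply: eq_bigr => B _.
by rewrite kmulvE !mulrA; congr (_ * _ * _); rewrite mulrC.
Qed.

Lemma kmulv_mulg a b x : T a (E b x) = E b (T a x).
Proof.
apply/ffunP => A; rewrite kmulvE !kmulgE; case: ifP => _; rewrite ?mulr0 //.
by rewrite kmulvE mulrCA.
Qed.

Lemma kmulv_eq0 a b x : t a * t b = 0 -> T a (T b x) = 0.
Proof. by move=> tab; apply/ffunP => A; rewrite !kmulvE mulrA tab mul0r ffunE. Qed.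

Lemma koszul_diff1 : d 1 = 0.
Proof.
apply/ffunP => A; rewrite koszul_diffE [RHS]ffunE big1 // => i _.
rewrite koszul1E; case: eqP => [/setP/(_ i)|]; last by rewrite mulr0.
by rewrite setU11 inE.
Qed.

Lemma koszul_diff_mulv a x : d (T a x) = T a (d x).
Proof.
apply/ffunP => A; rewrite kmulvE !koszul_diffE mulr_sumr; apply: eq_bigr => i _.
by rewrite kmulvE mulrCA.
Qed.

Lemma koszul_diff_kgen a x : d (kgen a) * x = T a x.
Proof.
have -> : d (kgen a) = T a 1.
  apply/ffunP => A; rewrite koszul_diffE kmulvE koszul1E.
  have [->|/set0Pn[j jA]] := eqVneq A set0.
    rewrite (bigD1 a) ?inE //= ninv0r expr0 ffunE setU0 eqxx mul1r.
    rewrite big1 ?addr0 // => i /andP[_ /negPf nia]; rewrite ffunE setU0.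
    by case: eqP => [/set1_inj/eqP|]; rewrite ?nia ?mulr0.
  rewrite mulr0 big1 // => i iA; rewrite ffunE; case: eqP => [eqA|]; rewrite ?mulr0 //.
  have := set11 i; have := setU11 i A; rewrite eqA !inE => /eqP ia _.
  have := setU1r i jA; rewrite eqA -ia inE => /eqP ji.
  by rewrite -ji jA in iA.
by rewrite -kmulvM mul1r.
Qed.

Lemma koszul_diff_mulg a x : d (E a x) = T a x - E a (d x).
Proof.
rewrite /E koszul_leibniz koszul_diff_kgen -mulNr; congr (_ + _ * _).
apply/ffunP => A; rewrite koszul_sgnE koszulNE ffunE.
by case: eqP => [->|]; rewrite ?cards1 ?expr1 ?mulN1r ?mulr1 ?mulr0 ?oppr0.
Qed.

Lemma kmulg_anti a b x : a != b -> E a (E b x) = - E b (E a x).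
Proof.
move=> ab; apply/ffunP => A; rewrite koszulNE !kmulgE !inE ab eq_sym ab /=.
case: ifP => aA; case: ifP => bA; rewrite ?mulr0 ?oppr0 //.
have -> : A :\ b :\ a = A :\ a :\ b by rewrite !setDDl setUC.
have eqa : A :\ a = [set b] :|: (A :\ a :\ b).
  by rewrite setD1K // !inE eq_sym ab.
have eqb : A :\ b = [set a] :|: (A :\ a :\ b).
  by rewrite -[A :\ a :\ b](_ : A :\ b :\ a = _) ?setD1K ?inE ?ab // !setDDl setUC.
set C := A :\ a :\ b in eqa eqb *.
have [aC bC] : a \notin C /\ b \notin C by rewrite !inE !eqxx andbF.
rewrite eqa eqb !ninvUr ?disjoints1 // !exprD.
have : (ninv [set a] [set b] + ninv [set b] [set a])%N = 1%N.
  by rewrite ninv1D ?inE ?cards1.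
move: (x C) ((-1) ^+ ninv [set a] C) ((-1) ^+ ninv [set b] C) => u s1 s2.
case: (ninv [set a] _) => [|[|//]]; rewrite ?add0n ?add1n.
  by move=> ->; rewrite expr0 expr1; ring.
by case=> ->; rewrite expr0 expr1; ring.
Qed.

Definition gen_free a x : Prop := forall A, a \in A -> x A = 0.

Lemma gen_freeD a x y : gen_free a x -> gen_free a y -> gen_free a (x + y).
Proof. by move=> fx fy A aA; rewrite koszulDE fx // fy // addr0. Qed.

Lemma gen_free_diff a x : gen_free a x -> gen_free a (d x).
Proof.
move=> fx A aA; rewrite koszul_diffE big1 // => i _.
by rewrite fx ?mulr0 // inE aA orbT.
Qed.

(** Coefficients at sets containing [a] see only [x], the others only [T a y]. One cannot conclude
    [y = 0], as T_a may be a zero divisor. *)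
Lemma kmulgv_eq0 a x y : gen_free a x -> gen_free a y ->
  E a x + T a y = 0 -> x = 0 /\ T a y = 0.
Proof.
move=> fx fy /ffunP xy0; have x0 : x = 0.
  apply/ffunP => A; rewrite [RHS]ffunE; have [/fx//|aA] := boolP (a \in A).
  have := xy0 (a |: A); rewrite koszulDE [RHS]ffunE kmulvE fy ?setU11 // mulr0 addr0.
  rewrite kmulgE setU11 setU1K // => /(congr1 ( *%R ((-1) ^+ ninv [set a] A))).
  by rewrite mulr0 mulrA -expr2 sqrr_sign mul1r.
by split=> //; apply/ffunP => A; have := xy0 A; rewrite x0 linear0 add0r.
Qed.
End KoszulOperators.

(** * The multigrading *)

Lemma signr_mulZ (k : fieldType) (R : comAlgType k) e (c : k) (r : R) :
  (-1) ^+ e * (c *: r) = ((-1) ^+ e * c) *: r.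
Proof.
rewrite -[in LHS]signr_odd -[in RHS]signr_odd.
by case: odd; rewrite ?expr1 ?expr0 ?mulN1r ?mul1r ?scaleNr.
Qed.

Section Multigrading.
Variables (k : fieldType) (n : nat) (G : rel 'I_n).
Local Notation R := (edge_ring k G).
Local Notation t := (edge_gens k G).
Local Notation K := (koszul R n).
Local Notation d := (koszul_diff t).
Local Notation E := (@kmulg k R n).
Local Notation T := (kmulv t).
Implicit Types (x y p q : K) (A B : {set 'I_n}) (a b i : 'I_n) (u m : 'X_{1..n}).

Definition mset A : 'X_{1..n} := [multinom (i \in A : nat) | i < n].

Lemma msetE A i : mset A i = (i \in A). Proof. exact: mnmE. Qed.

Lemma msetU1 a A : a \notin A -> mset (a |: A) = (U_(a) + mset A)%MM.
Proof.
move=> aA; apply/mnmP => i; rewrite mnmDE mnm1E !msetE !inE eq_sym.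
by case: eqP => [<-|//]; rewrite (negPf aA).
Qed.

(* [x] has multidegree [u], where both [T_i] and [e_i] have degree [U_(i)]. *)
Definition kdeg u x : Prop := forall A,
  x A = 0 \/ exists m c, u = (mset A + m)%MM /\ x A = c *: emon k G m.

Lemma kdeg0 u : kdeg u 0.
Proof. by move=> A; left; rewrite ffunE. Qed.

Lemma kdegD u x y : kdeg u x -> kdeg u y -> kdeg u (x + y).
Proof.
move=> ux uy A; rewrite koszulDE.
have [->|[m [c [um ->]]]] := ux A; first by rewrite add0r; apply: uy.
have [->|[m' [c' [um' ->]]]] := uy A; first by rewrite addr0; right; exists m, c.
right; exists m, (c + c'); split=> //.
by move: um'; rewrite um => /addmI <-; rewrite scalerDl.
Qed.

Lemma kdegZ u (c : k) x : kdeg u x -> kdeg u (c *: x).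
Proof.
move=> ux A; rewrite koszulZE; have [->|[m [c' [um ->]]]] := ux A.
  by left; rewrite scaler0.
by right; exists m, (c * c'); rewrite scalerA.
Qed.

Lemma kdegN u x : kdeg u x -> kdeg u (- x).
Proof. by rewrite -scaleN1r; apply: kdegZ. Qed.

Lemma kdegB u x y : kdeg u x -> kdeg u y -> kdeg u (x - y).
Proof. by move=> ux uy; apply: kdegD => //; apply: kdegN. Qed.

Lemma kdeg_mulg u a x : kdeg u x -> kdeg (U_(a) + u) (E a x).
Proof.
move=> ux A; rewrite kmulgE; case: ifP => aA; last by left.
have [->|[m [c [-> ->]]]] := ux (A :\ a); first by left; rewrite mulr0.
right; exists m, ((-1) ^+ ninv [set a] (A :\ a) * c); split.
  by rewrite addmA -msetU1 ?setD1K // !inE eqxx.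
by rewrite signr_mulZ.
Qed.

Lemma kdeg_mulv u a x : kdeg u x -> kdeg (U_(a) + u) (T a x).
Proof.
move=> ux A; rewrite kmulvE; have [->|[m [c [-> ->]]]] := ux A.
  by left; rewrite mulr0.
right; exists (U_(a) + m)%MM, c; rewrite edge_gensE -scalerAr -emonD.
by rewrite !addmA [(U_(a) + _)%MM]addmC.
Qed.

Lemma kdeg_diff u x : kdeg u x -> kdeg u (d x).
Proof.
move=> ux A; rewrite koszul_diffE.
pose P (r : R) := r = 0 \/ exists m c, u = (mset A + m)%MM /\ r = c *: emon k G m.
apply: (big_ind P) => [|r s|i iA]; first by left.
  move=> [->|[m [c [um ->]]]]; first by rewrite add0r.
  move=> [->|[m' [c' [um' ->]]]]; first by rewrite addr0; right; exists m, c.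
  right; exists m, (c + c'); split=> //.
  by move: um'; rewrite um => /addmI <-; rewrite scalerDl.
rewrite /P; have [->|[m [c [-> ->]]]] := ux (i |: A); first by left; rewrite mulr0.
right; exists (U_(i) + m)%MM, ((-1) ^+ ninv [set i] A * c).
rewrite msetU1 // -addmA addmCA; split=> //.
by rewrite edge_gensE -mulrA -scalerAr -emonD signr_mulZ.
Qed.

Lemma kdeg_free u a x : kdeg u x -> u a = 0%N -> gen_free a x.
Proof.
move=> ux ua A aA; have [//|[m [c [um _]]]] := ux A.
by move: ua; rewrite um mnmDE msetE aA.
Qed.

Lemma kdeg_one : kdeg 0 1.
Proof.
move=> A; rewrite koszul1E; case: eqP => [->|]; last by left.
right; exists 0%MM, 1; rewrite scale1r /emon mpolyX0.
split; last exact/esym/(rmorph1 (edge_pi G)).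
by apply/mnmP => i; rewrite mnmDE msetE inE mnm0E.
Qed.

Lemma kdeg0P x : kdeg 0 x -> exists c, x = c *: 1.
Proof.
move=> x0; have xA A : A != set0 -> x A = 0.
  case/set0Pn=> a aA; have [//|[m [c [/mnmP/(_ a)]]]] := x0 A.
  by rewrite mnm0E mnmDE msetE aA.
have [x00|[m [c [m0 xE]]]] := x0 set0; [exists 0 | exists c];
  apply/ffunP => A; rewrite koszulZE koszul1E; case: eqP => [->|/eqP/xA->].
- by rewrite scale0r.
- by rewrite scaler0.
- have m_0 : m = 0%MM.
    by apply/mnmP => i; move/mnmP/(_ i): m0; rewrite mnmDE msetE inE add0n.
  by rewrite xE m_0 /emon mpolyX0 (rmorph1 (edge_pi G)).
- by rewrite scaler0.
Qed.

(** Every term of [x] contains e_a or T_a: the terms with e_a make up [E a p], the others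
    [T a q]. *)
Lemma kdeg_split u a x : kdeg (U_(a) + u) x -> exists p q,
  [/\ kdeg u p, kdeg u q, gen_free a p, gen_free a q & x = E a p + T a q].
Proof.
move=> ux.
pose p : K := [ffun A : {set 'I_n} =>
  if a \in A then 0 else (-1) ^+ ninv [set a] A * x (a |: A)].
(* When e_a is absent, the coefficient has a positive exponent at [a], and T_a is divided out on
   monomials. The quotient has to be chosen since [R] has zero divisors. *)
have /choice[q0 q0P] : forall A, exists r : R, a \notin A ->
    (r = 0 \/ exists m c, u = (mset A + m)%MM /\ r = c *: emon k G m) /\ x A = t a * r.
  move=> A; have [->|[m [c [um ->]]]] := ux A.
    by exists 0; rewrite mulr0; split=> //; left.
  exists (c *: emon k G (m - U_(a))) => aA.
  have ma : (U_(a) <= m)%MM.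
    apply/mnm_lepP => i; rewrite mnm1E; case: eqP => // <-.
    by move/mnmP/(_ a): um; rewrite !mnmDE mnm1E eqxx msetE (negPf aA) add0n => <-.
  split; last by rewrite edge_gensE -scalerAr -emonD addmC submK.
  right; exists (m - U_(a))%MM, c; split=> //; apply: (@addmI _ U_(a)%MM).
  by rewrite um addmCA [(U_(a) + _)%MM]addmC submK.
exists p, [ffun A : {set 'I_n} => if a \in A then 0 else q0 A]; split.
- move=> A; rewrite ffunE; case: ifPn => aA; first by left.
  have [->|[m [c [um ->]]]] := ux (a |: A); first by left; rewrite mulr0.
  right; exists m, ((-1) ^+ ninv [set a] A * c); rewrite signr_mulZ; split=> //.
  by apply: (@addmI _ U_(a)%MM); rewrite um msetU1 ?addmA.
- move=> A; rewrite ffunE; case: ifPn => aA; first by left.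
  by have [] := q0P A aA.
- by move=> A aA; rewrite ffunE aA.
- by move=> A aA; rewrite ffunE aA.
apply/ffunP => A; rewrite koszulDE kmulgE kmulvE !ffunE !inE eqxx /=.
case: ifPn => aA; last by rewrite add0r; have [] := q0P A aA.
by rewrite mulr0 addr0 mulrA -expr2 sqrr_sign mul1r setD1K.
Qed.

Lemma kmulv_cancel u a q : irreflexive G -> ssrbool.symmetric G ->
  kdeg u q -> gen_free a q ->
  u a != 0%N \/ nonadjacent G a u -> T a q = 0 -> q = 0.
Proof.
move=> Girr Gsym uq fq au /ffunP Tq; apply/ffunP => A; rewrite [RHS]ffunE.
have [//|aA] := boolP (a \in A); first exact: fq.
have := Tq A; rewrite kmulvE [RHS]ffunE.
have [->//|[m [c [um ->]]]] := uq A; apply: emon_cancel => //.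
case: au => [|sep]; first by rewrite um mnmDE msetE (negPf aA); left.
by right=> i mi; apply: sep; rewrite um mnmDE addn_eq0 negb_and mi orbT.
Qed.

(** The guard is there because subtraction of exponents is truncated. *)
Definition kproj u x : K :=
  [ffun A : {set 'I_n} =>
     if (mset A <= u)%MM then edge_coeff (u - mset A)%MM (x A) else 0].

Lemma kproj_is_linear u : linear (kproj u).
Proof.
move=> c x y; apply/ffunP => A; rewrite koszulDE koszulZE !ffunE.
by case: ifP => _; rewrite ?scaler0 ?addr0 //= linearP.
Qed.
HB.instance Definition _ u :=
  GRing.isLinear.Build k K K *:%R (kproj u) (kproj_is_linear u).

Lemma kdeg_kproj u x : kdeg u (kproj u x).
Proof.
move=> A; rewrite ffunE; case: ifP => uA; last by left.
right; exists (u - mset A)%MM; rewrite /edge_coeff; eexists; split; last by [].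
by rewrite addmC submK.
Qed.

Lemma kproj_kdeg u v x : kdeg u x -> kproj v x = if u == v then x else 0.
Proof.
move=> ux; apply/ffunP => A; rewrite ffunE.
have [x0|[m [c [um xE]]]] := ux A.
  rewrite x0 linear0; by case: (u == v); case: ifP; rewrite ?x0 ?ffunE.
rewrite xE linearZ /= edge_coeff_emon scalerA; case: (eqVneq u v) => [<-|uv].
  by rewrite um lepm_addr [(mset A + m)%MM]addmC addmK eqxx mulr1.
case: ifP => vA; rewrite [RHS]ffunE //.
case: eqP => [mE|_]; rewrite ?mulr0 ?scale0r //.
by rewrite um mE addmC submK // eqxx in uv.
Qed.

(** Allowing every larger list [s'] makes the property additive: for a sum, concatenate the two
    lists. *)
Lemma koszul_sum_kdeg x : exists s : seq 'X_{1..n},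
  forall s', uniq s' -> {subset s <= s'} -> x = \sum_(u <- s') kproj u x.
Proof.
pose P x := exists s : seq 'X_{1..n},
  forall s', uniq s' -> {subset s <= s'} -> x = \sum_(u <- s') kproj u x.
have P0 : P 0 by exists [::] => s' _ _; rewrite big1 // => u _; rewrite linear0.
have PD y z : P y -> P z -> P (y + z).
  case=> sy Py [sz Pz]; exists (sy ++ sz) => s' Us' ss'.
  rewrite {1}(Py s') // 1?{1}(Pz s') //.
  - by rewrite -big_split; apply: eq_bigr => u _; rewrite linearD.
  - by move=> u us; apply: ss'; rewrite mem_cat us orbT.
  - by move=> u us; apply: ss'; rewrite mem_cat us.
have Pdeg u y : kdeg u y -> P y.
  move=> uy; exists [:: u] => s' Us' /(_ u); rewrite mem_head => /(_ isT) us'.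
  rewrite (bigD1_seq u) //= (kproj_kdeg _ uy) eqxx big1 ?addr0 // => v.
  by rewrite (kproj_kdeg _ uy) eq_sym => /negPf->.
pose single A (r : R) : K := [ffun B => if B == A then r else 0].
have -> : x = \sum_A single A (x A).
  apply/ffunP => B; rewrite sum_ffunE (bigD1 B) //= ffunE eqxx big1 ?addr0 // => A.
  by rewrite ffunE eq_sym => /negPf->.
apply: (big_ind P) => // A _.
have [s [c ->]] := edge_ring_sum (x A).
have -> : single A (\sum_(m <- s) c m *: emon k G m) =
          \sum_(m <- s) single A (c m *: emon k G m).
  apply/ffunP => B; rewrite sum_ffunE ffunE; case: eqP => [->|/eqP/negPf nBA].
    by apply: eq_bigr => m _; rewrite ffunE eqxx.
  by rewrite big1 // => m _; rewrite ffunE nBA.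
apply: (big_ind P) => // m _; apply: (Pdeg (mset A + m)%MM) => B.
by rewrite ffunE; case: eqP => [->|_]; [right; exists m, (c m) | left].
Qed.

(** As [d] preserves multidegrees, only the component of [x] in degree [u] contributes to degree [u]
    of [d x]. *)
Lemma koszul_diff_kproj u x : d (kproj u x) = kproj u (d x).
Proof.
have [s sP] := koszul_sum_kdeg x.
have xE : x = \sum_(v <- undup s) kproj v x.
  by apply: sP => [|v]; rewrite ?undup_uniq ?mem_undup.
rewrite {2}xE !linear_sum /=.
have dE v : kproj u (d (kproj v x)) = if v == u then d (kproj v x) else 0.
  by apply: kproj_kdeg; apply: kdeg_diff; apply: kdeg_kproj.
under eq_bigr => v _ do rewrite dE.
rewrite -big_mkcond.
have [us|us] := boolP (u \in undup s).
  by rewrite -big_filter filter_pred1_uniq ?undup_uniq // big_seq1.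
rewrite big1_seq => [|v /andP[/eqP-> us']]; last by rewrite us' in us.
rewrite xE linear_sum /= big1_seq ?linear0 // => v /andP[_ vs].
by rewrite (kproj_kdeg _ (kdeg_kproj v x)); case: eqP vs us => // -> ->.
Qed.

End Multigrading.

(** * Cycles near a leaf *)

Section Reductions.
Variables (k : fieldType) (n : nat) (G : rel 'I_n).
Hypotheses (Girr : irreflexive G) (Gsym : ssrbool.symmetric G).
Local Notation R := (edge_ring k G).
Local Notation t := (edge_gens k G).
Local Notation K := (koszul R n).
Local Notation d := (koszul_diff t).
Local Notation E := (@kmulg k R n).
Local Notation T := (kmulv t).
Implicit Types (x y p q : K) (a b c : 'I_n) (u : 'X_{1..n}).

Lemma mnm1D_eq0 a b u : (U_(b) + u)%MM a = 0%N -> u a = 0%N.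
Proof. by rewrite mnmDE => /eqP; rewrite addn_eq0 => /andP[_ /eqP]. Qed.

Lemma kmulv_edge a b x : G a b -> T a (T b x) = 0.
Proof. by move=> Gab; apply: kmulv_eq0; apply: edge_gens_edge. Qed.

Lemma kmulg_inj a x : gen_free a x -> E a x = 0 -> x = 0.
Proof.
move=> fx Ex; have f0 : gen_free a (0 : K) by move=> A _; rewrite ffunE.
by have [] := kmulgv_eq0 (t := t) fx f0; rewrite ?Ex ?linear0 ?addr0.
Qed.

Lemma koszul_diff_split a p q :
  d (E a p + T a q) = E a (- d p) + T a (p + d q).
Proof.
rewrite linearD /= koszul_diff_mulg koszul_diff_mulv linearN linearD /=.
by rewrite addrAC addrA addrC addrA.
Qed.

(** By [koszul_diff_split] the cycle condition separates: [p] is a cycle, and [p] equals [- d q] up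
    to the annihilator of T_a. *)
Lemma kdeg_cycle_split u a x : kdeg (U_(a) + u)%MM x -> d x = 0 ->
  exists p q, [/\ kdeg u p, kdeg u q, gen_free a (p + d q) &
    [/\ x = E a p + T a q, d p = 0 & T a (p + d q) = 0]].
Proof.
move=> ux; have [p [q [up uq fp fq ->]]] := kdeg_split ux.
rewrite koszul_diff_split.
have fdp : gen_free a (- d p).
  by move=> A aA; rewrite koszulNE (gen_free_diff _ fp) ?oppr0.
have fpq : gen_free a (p + d q) by apply: gen_freeD => //; apply: gen_free_diff.
case/(kmulgv_eq0 fdp fpq) => /eqP; rewrite oppr_eq0 => /eqP dp Tpq.
by exists p, q.
Qed.

(** Here T_a can be cancelled, so [p = - d q] and [E a p + T a q] is [d (E a q)]. *)
Lemma kdeg_cycle_isolated u a x : u a != 0%N \/ nonadjacent G a u ->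
  kdeg (U_(a) + u)%MM x -> d x = 0 -> exists2 q, kdeg u q & x = d (E a q).
Proof.
move=> au ux dx; have [p [q [up uq fpq [-> dp Tpq]]]] := kdeg_cycle_split ux dx.
exists q => //.
have /eqP := kmulv_cancel Girr Gsym (kdegD up (kdeg_diff uq)) fpq au Tpq.
by rewrite addr_eq0 => /eqP->; rewrite koszul_diff_mulg linearN addrC.
Qed.

Lemma kdeg_cycle_square u a x : (1 < u a)%N -> kdeg u x -> d x = 0 ->
  exists y, x = d y.
Proof.
move=> ua; rewrite {1}(mnm_split (lt0n_neq0 (ltnW ua))) => ux dx.
have au : (u - U_(a))%MM a != 0%N by rewrite mnmBE mnm1E eqxx subn_eq0 -ltnNge.
by have [q _ ->] := kdeg_cycle_isolated (or_introl au) ux dx; exists (E a q).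
Qed.

(** The only neighbour of [a] in sight is [b], so what T_a kills is divisible by T_b: in
    [x = E b p + T b q], T_a can be cancelled from [T a p = 0]. *)
Lemma kmulv_kernel u a b x : G a b -> nonadjacent G a u ->
  (U_(b) + u)%MM a = 0%N -> u b = 0%N -> kdeg (U_(b) + u)%MM x -> T a x = 0 ->
  exists2 h, kdeg u h & x = T b h.
Proof.
move=> Gab au ua ub ux; have [p [q [up uq fp fq ->]]] := kdeg_split ux.
rewrite linearD /= kmulv_edge // addr0 kmulv_mulg => Ep.
exists q => //.
have fTp : gen_free b (T a p) by move=> A bA; rewrite kmulvE fp ?mulr0.
have ua0 := mnm1D_eq0 ua.
have fpa : gen_free a p by apply: kdeg_free ua0.
have p0 := kmulv_cancel Girr Gsym up fpa (or_intror au) (kmulg_inj fTp Ep).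
by rewrite p0 linear0 add0r.
Qed.

(** Subtracting [d (E a q)] turns the cycle into [E a (p + d q)], and T_a kills [p + d q], so that
    [kmulv_kernel] applies. At this stage [h] is a cycle only after multiplication by T_b. *)
Lemma kdeg_cycle_leaf u a b x : G a b -> nonadjacent G a u ->
  (U_(b) + u)%MM a = 0%N -> u b = 0%N ->
  kdeg (U_(a) + (U_(b) + u))%MM x -> d x = 0 ->
  exists q h, [/\ kdeg (U_(b) + u)%MM q, kdeg u h,
                  x = d (E a q) + E a (T b h) & T b (d h) = 0].
Proof.
move=> Gab au ua ub ux dx.
have [p [q [up uq fpq [xE dp Tpq]]]] := kdeg_cycle_split ux dx.
have upq := kdegD up (kdeg_diff uq).
have [h uh pqE] := kmulv_kernel Gab au ua ub upq Tpq.
exists q, h; split=> //.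
  by rewrite -pqE koszul_diff_mulg linearD /= xE addrA addrAC subrK addrC.
by rewrite -koszul_diff_mulv -pqE linearD /= dp koszul_diffK addr0.
Qed.

(** As T_b T_c = 0, multiplication by T_b sees only the terms of [x] that contain e_c. *)
Lemma kmulv_link u b c x : G b c -> u c = 0%N -> kdeg (U_(c) + u)%MM x ->
  exists2 h, kdeg u h &
    T b x = T b (E c h) /\ (T b (d x) = 0 -> T b (d h) = 0).
Proof.
move=> Gbc uc ux; have [h [q [uh uq fh fq ->]]] := kdeg_split ux.
exists h => //; have TE : T b (E c h + T c q) = T b (E c h).
  by rewrite linearD /= kmulv_edge // addr0.
split=> //; rewrite -koszul_diff_mulv TE koszul_diff_mulv koszul_diff_mulg.
rewrite linearB /= kmulv_edge // add0r kmulv_mulg -linearN => Tdh.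
have fTdh : gen_free c (- T b (d h)).
  by move=> A cA; rewrite koszulNE kmulvE (gen_free_diff _ fh cA) mulr0 oppr0.
by have /eqP := kmulg_inj fTdh Tdh; rewrite oppr_eq0 => /eqP.
Qed.

(** After e_c is extracted, nothing in [u] is adjacent to [b], so T_b cancels from
    [T b (d h) = 0]. *)
Lemma kdeg_cycle_leaf3 u a b c x : G a b -> G b c ->
  nonadjacent G a (U_(c) + u)%MM -> nonadjacent G b u ->
  (U_(b) + (U_(c) + u))%MM a = 0%N -> (U_(c) + u)%MM b = 0%N -> u c = 0%N ->
  kdeg (U_(a) + (U_(b) + (U_(c) + u)))%MM x -> d x = 0 ->
  exists q h, [/\ kdeg (U_(b) + (U_(c) + u))%MM q, kdeg u h, d h = 0 &
                  x = d (E a q) + E a (T b (E c h))].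
Proof.
move=> Gab Gbc acu bu ua ub uc ux dx.
have [q [h' [uq uh' -> Tdh']]] := kdeg_cycle_leaf Gab acu ua ub ux dx.
have [h uh [-> /(_ Tdh') Tdh]] := kmulv_link Gbc uc uh'.
exists q, h; split=> //.
have fb : gen_free b (d h) by apply: (kdeg_free (kdeg_diff uh)); apply: mnm1D_eq0 ub.
exact: (kmulv_cancel Girr Gsym (kdeg_diff uh) fb (or_intror bu)).
Qed.

(** Stripping three vertices also reflects boundaries: the leaf reduction is run on the bounding
    chain [x] instead of on a cycle. *)
Lemma kdeg_boundary_leaf3 u a b c x r : G a b -> G b c ->
  nonadjacent G a (U_(c) + u)%MM -> nonadjacent G b u ->
  (U_(b) + (U_(c) + u))%MM a = 0%N -> (U_(c) + u)%MM b = 0%N -> u c = 0%N ->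
  kdeg u r -> kdeg (U_(a) + (U_(b) + (U_(c) + u)))%MM x ->
  E a (T b (E c r)) = d x -> exists2 h, kdeg u h & r = d h.
Proof.
move=> Gab Gbc acu bu ua ub uc ur ux.
have [p [q [up uq fp fq ->]]] := kdeg_split ux.
rewrite koszul_diff_split => eqr.
have uEr : kdeg (U_(b) + (U_(c) + u))%MM (T b (E c r)).
  by apply: kdeg_mulv; apply: kdeg_mulg.
have fr : gen_free a (T b (E c r) + d p).
  by apply: gen_freeD; [apply: kdeg_free uEr ua | apply: gen_free_diff].
have fpq : gen_free a (- (p + d q)).
  move=> A aA; rewrite koszulNE (gen_freeD fp _ aA) ?oppr0 //.
  exact: gen_free_diff.
have [] : T b (E c r) + d p = 0 /\ T a (- (p + d q)) = 0.
  apply: kmulgv_eq0 => //; rewrite [E a _]linearD [T a _]linearN /= eqr.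
  by rewrite [E a (- _)]linearN /= [- _ + T a _]addrC subrK subrr.
move=> rE /eqP; rewrite linearN oppr_eq0 => /eqP /= Tpq.
have upq := kdegD up (kdeg_diff uq).
have [h' uh' pqE] := kmulv_kernel Gab acu ua ub upq Tpq.
have [h uh [hE _]] := kmulv_link Gbc uc uh'.
exists h => //.
have pE : p = T b (E c h) - d q by rewrite -hE -pqE addrK.
(* The e_a part says [T b (E c r) = - d p], and [p = T b (E c h) - d q] has differential
   [- T b (E c (d h))]; then e_c is cancelled. *)
have Tr : T b (r - d h) = 0.
  apply: (@kmulg_inj c).
    move=> A cA; rewrite kmulvE (_ : (r - _) A = 0) ?mulr0 //.
    exact: (kdeg_free (kdegB ur (kdeg_diff uh)) uc cA).
  rewrite -kmulv_mulg [E c _]linearB /= linearB /= -[RHS]rE pE linearB /=.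
  rewrite koszul_diffK subr0 koszul_diff_mulv koszul_diff_mulg linearB /=.
  by rewrite kmulv_edge // sub0r.
have urh := kdegB ur (kdeg_diff uh).
have frh : gen_free b (r - d h) by apply: (kdeg_free urh); apply: mnm1D_eq0 ub.
have /eqP := kmulv_cancel Girr Gsym urh frh (or_intror bu) Tr.
by rewrite subr_eq0 => /eqP.
Qed.

End Reductions.

(** * Forests *)

Section GeneratedClasses.
Variables (k : fieldType) (n : nat) (G : rel 'I_n).
Local Notation R := (edge_ring k G).
Local Notation t := (edge_gens k G).
Local Notation K := (koszul R n).
Local Notation d := (koszul_diff t).
Local Notation E := (@kmulg k R n).
Local Notation T := (kmulv t).
Implicit Types (x y : K) (a b c : 'I_n) (u : 'X_{1..n}).

Lemma edge_ring_homogM e e' (r s : R) : edge_ring_homog e r ->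
  edge_ring_homog e' s -> edge_ring_homog (e + e') (r * s).
Proof.
case=> p hp -> [q hq ->]; exists (p * q); last by rewrite rmorphM.
exact: dhomogM.
Qed.

Lemma edge_ring_homog_sign i : @edge_ring_homog k n G 0 ((-1) ^+ i).
Proof.
exists ((-1) ^+ i); last by rewrite rmorphXn rmorphN1.
by rewrite -signr_odd; case: odd; rewrite ?expr1 ?expr0 ?dhomogN dhomog1.
Qed.

Lemma koszul_bidegree1 : koszul_bidegree 0 0 (1 : K).
Proof.
move=> A; rewrite koszul1E; have [->|_] := eqVneq A set0; last by rewrite eqxx.
by rewrite cards0; split=> //; exists 0%N => //; exists 1; rewrite ?dhomog1 ?rmorph1.
Qed.

Lemma koszul_bidegree_mulg i j a x :
  koszul_bidegree i j x -> koszul_bidegree i.+1 j.+1 (E a x).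
Proof.
move=> xij A; rewrite kmulgE; case: ifP => [aA|]; last by rewrite eqxx.
have [->|xA _] := eqVneq (x (A :\ a)) 0; first by rewrite mulr0 eqxx.
have [<- [e eE he]] := xij _ xA; split; first by rewrite (cardsD1 a A) aA.
exists e; first by rewrite addnS eE.
by rewrite -[e]add0n; apply: edge_ring_homogM => //; apply: edge_ring_homog_sign.
Qed.

Lemma koszul_bidegree_mulv i j a x :
  koszul_bidegree i j x -> koszul_bidegree i j.+1 (T a x).
Proof.
move=> xij A; rewrite kmulvE.
have [->|xA _] := eqVneq (x A) 0; first by rewrite mulr0 eqxx.
have [<- [e eE he]] := xij _ xA; split=> //.
exists e.+1; first by rewrite addSn eE.
rewrite -add1n; apply: edge_ring_homogM => //; exists 'X_a => //.
by rewrite dhomogX; apply/eqP/mdeg1.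
Qed.

Section InSubalgebra.
Variable P : {pred koszul_homology k G}.
Hypothesis Psub : subalg_closed P.

(** Membership is phrased for chains, because the reductions produce chains and not bundled
    cycles. *)
Definition class_in x : Prop :=
  exists2 z : koszul_cycle t, val z = x & homology_class z \in P.

Lemma class_in_cycle x : class_in x -> d x = 0.
Proof. by case=> z <- _; apply: koszul_cycleE. Qed.

Lemma class_in_one : class_in 1.
Proof. by exists 1; rewrite ?rmorph1 //; case: Psub. Qed.

Lemma class_inM x y : class_in x -> class_in y -> class_in (x * y).
Proof.
case=> z <- Pz [w <- Pw]; exists (z * w); rewrite ?rmorphM //.
by case: Psub => _ _; apply.
Qed.

Lemma class_in_lin (c : k) x y : class_in x -> class_in y -> class_in (c *: x + y).
Proof.
case=> z <- Pz [w <- Pw]; exists (c *: z + w); rewrite ?linearP //.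
by case: Psub => _ + _; apply.
Qed.

Lemma class_in0 : class_in 0.
Proof.
have := class_in_lin (-1) class_in_one class_in_one.
by rewrite scaleN1r addNr.
Qed.

Lemma class_inD x y : class_in x -> class_in y -> class_in (x + y).
Proof. by move=> Px Py; rewrite -[x]scale1r; apply: class_in_lin. Qed.

Lemma class_inZ (c : k) x : class_in x -> class_in (c *: x).
Proof. by move=> Px; rewrite -[_ *: _]addr0; apply: class_in_lin class_in0. Qed.

Lemma class_in_diff x : class_in (d x).
Proof.
have dd : d x \in koszul_cycles t by rewrite unfold_in koszul_diffK.
exists (KoszulCycle dd) => //.
have /eqP -> : homology_class (KoszulCycle dd) == 0.
  by rewrite homology_class_eq0; apply/asboolP; exists x.
have [z z0 Pz] := class_in0; suff <- : homology_class z = 0 by [].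
by apply/eqP; rewrite homology_class_eq0; apply/asboolP; exists 0; rewrite linear0.
Qed.

Lemma class_in_bidegree i j x :
  (forall h : koszul_homology k G, homology_bidegree i j h -> h \in P) ->
  koszul_bidegree i j x -> d x = 0 -> class_in x.
Proof.
move=> Pij xij dx.
have xc : x \in koszul_cycles t by rewrite unfold_in dx.
by exists (KoszulCycle xc) => //; apply: Pij; exists (KoszulCycle xc).
Qed.

Hypothesis P12 : forall h : koszul_homology k G, homology_bidegree 1 2 h -> h \in P.
Hypothesis P23 : forall h : koszul_homology k G, homology_bidegree 2 3 h -> h \in P.

Lemma class_in_edge a b x : G a b -> class_in x -> class_in (E a (T b x)).
Proof.
move=> Gab Px; rewrite -[x]mul1r kmulvM kmulgM; apply: class_inM => //.
apply: class_in_bidegree P12 _ _.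
  by apply/koszul_bidegree_mulg/koszul_bidegree_mulv/koszul_bidegree1.
rewrite koszul_diff_mulg kmulv_edge // koszul_diff_mulv.
by rewrite koszul_diff1 [T b 0]linear0 [E a 0]linear0 subr0.
Qed.

Lemma class_in_path a b c x : G a b -> G b c ->
  class_in x -> class_in (E a (T b (E c x))).
Proof.
move=> Gab Gbc Px; rewrite -[x]mul1r kmulgM kmulvM kmulgM.
apply: class_inM => //; apply: class_in_bidegree P23 _ _.
  apply/koszul_bidegree_mulg/koszul_bidegree_mulv/koszul_bidegree_mulg.
  exact: koszul_bidegree1.
rewrite koszul_diff_mulg kmulv_edge // koszul_diff_mulv koszul_diff_mulg.
by rewrite koszul_diff1 linear0 subr0 kmulv_edge // linear0 subr0.
Qed.

(** [F] is a hereditary family of multidegrees whose supports have a vertex [a] with at most the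
    neighbour [b], itself with at most one further neighbour [c]. By induction on total degree: if
    [a] is isolated the cycle bounds, otherwise e_a T_b or e_a T_b e_c splits off. *)
Lemma class_in_forest (F : 'X_{1..n} -> Prop) :
  irreflexive G -> ssrbool.symmetric G ->
  (forall u v, F (u + v)%MM -> F v) ->
  (forall u, F u -> u != 0%MM -> exists a b c,
     [/\ u a != 0%N, forall i, u i != 0%N -> G a i -> i = b
       & forall i, u i != 0%N -> G b i -> i = a \/ i = c]) ->
  forall u x, F u -> kdeg u x -> d x = 0 -> class_in x.
Proof.
move=> Girr Gsym Fsub Fleaf u.
have [N] := ubnP (mdeg u); elim: N u => // N IH u; rewrite ltnS => uN x Fu ux dx.
have [u0|/(Fleaf u Fu)[a [b [c [ua ab bc]]]]] := eqVneq u 0%MM.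
  rewrite u0 in ux; have [e ->] := kdeg0P ux.
  exact: class_inZ class_in_one.
have [/existsP[i ui]|] := boolP [exists i, (1 < u i)%N].
  have [y ->] := kdeg_cycle_square Girr Gsym ui ux dx.
  exact: class_in_diff.
rewrite negb_exists => /forallP u1.
have [v uE] : exists v, u = (U_(a) + v)%MM by eexists; apply: mnm_split ua.
have va : v a = 0%N by have := u1 a; rewrite uE mnmDE mnm1E eqxx -leqNgt; case: (v a).
have uv i : v i != 0%N -> u i != 0%N by rewrite uE mnmDE addn_eq0 negb_and orbC => ->.
have uab : forall i, v i != 0%N -> G a i -> i = b by move=> i /uv; apply: ab.
(* All entries of [u] are now at most 1, so a vertex once split off does not recur. *)
have bounded i (w w' : 'X_{1..n}) : u = (w' + (U_(i) + w))%MM -> w i = 0%N.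
  move=> uE'; have := u1 i; rewrite uE' !mnmDE mnm1E eqxx -leqNgt.
  by case: (w i) => // l; rewrite add1n !addnS.
have nonadj_or i (w : 'X_{1..n}) : nonadjacent G i w \/ exists2 j, w j != 0%N & G i j.
  have [/existsP[j /andP[]]|] := boolP [exists j, (w j != 0%N) && G i j].
    by right; exists j.
  rewrite negb_exists => /forallP wi; left=> j wj.
  by move: (wi j); rewrite wj.
have [av|[b' vb Gab]] := nonadj_or a v.
  rewrite uE in ux.
  have [q _ ->] := kdeg_cycle_isolated Girr Gsym (or_intror av) ux dx.
  exact: class_in_diff.
have b'E := uab _ vb Gab; rewrite {}b'E in vb Gab.
have [w vE] : exists w, v = (U_(b) + w)%MM by eexists; apply: mnm_split vb.
rewrite {}vE in va uv uab uE.
have wb : w b = 0%N by apply: (bounded b w U_(a)%MM).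
have aw : nonadjacent G a w.
  move=> i wi; apply/negP => Gai; have ib : i = b.
    by apply: uab => //; rewrite mnmDE addn_eq0 negb_and wi orbT.
  by rewrite ib wb in wi.
have uw i : w i != 0%N -> u i != 0%N.
  by move=> wi; apply: uv; rewrite mnmDE addn_eq0 negb_and wi orbT.
have [bw|[c' wc Gbc]] := nonadj_or b w.
  rewrite uE in ux Fu uN.
  have [q [h [uq uh xE Th]]] := kdeg_cycle_leaf Girr Gsym Gab aw va wb ux dx.
  rewrite xE; apply: class_inD; first exact: class_in_diff.
  apply: class_in_edge => //; apply: (IH w) => //; last 1 first.
  - have fh := kdeg_free (kdeg_diff uh) wb.
    exact: (kmulv_cancel Girr Gsym (kdeg_diff uh) fh (or_intror bw)).
  - by apply: leq_trans uN; rewrite !mdegD !mdeg1 !add1n.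
  - by apply: (Fsub U_(b)%MM); apply: (Fsub U_(a)%MM).
have [c'a|c'E] := bc _ (uw _ wc) Gbc.
  by rewrite c'a (mnm1D_eq0 va) in wc.
rewrite {}c'E in wc Gbc.
have [w' wE] : exists w', w = (U_(c) + w')%MM by eexists; apply: mnm_split wc.
rewrite {}wE in va wb aw uw uE uab uv wc.
have w'c : w' c = 0%N by apply: (bounded c w' (U_(a) + U_(b))%MM); rewrite -addmA.
have bw' : nonadjacent G b w'.
  move=> i w'i; apply/negP => Gbi.
  have [] := bc i _ Gbi.
  - by apply: uw; rewrite mnmDE addn_eq0 negb_and w'i orbT.
  - by move=> ia; rewrite ia (mnm1D_eq0 (mnm1D_eq0 va)) in w'i.
  - by move=> ic; rewrite ic w'c in w'i.
rewrite uE in ux Fu uN.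
have [q [h [uq uh dh ->]]] :=
  kdeg_cycle_leaf3 Girr Gsym Gab Gbc aw bw' va wb w'c ux dx.
apply: class_inD; first exact: class_in_diff.
apply: class_in_path => //; apply: (IH w') => //.
- by apply: leq_trans uN; rewrite !mdegD !mdeg1 !add1n ltnS; do 2 apply: leqW.
- by apply: (Fsub U_(c)%MM); apply: (Fsub U_(b)%MM); apply: (Fsub U_(a)%MM).
Qed.
End InSubalgebra.
End GeneratedClasses.

(** * Induced paths *)

Lemma seq_ind3 (A : Type) (P : seq A -> Prop) : P [::] -> (forall a, P [:: a]) ->
  (forall a b, P [:: a; b]) -> (forall a b c s, P s -> P [:: a, b, c & s]) ->
  forall s, P s.
Proof.
move=> P0 P1 P2 P3; fix IH 1; case=> [|a [|b [|c s]]].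
- exact: P0.
- exact: P1.
- exact: P2.
- exact/P3/IH.
Qed.

Section InducedPaths.
Variables (k : fieldType) (n : nat) (G : rel 'I_n).
Hypotheses (Girr : irreflexive G) (Gsym : ssrbool.symmetric G).
Local Notation R := (edge_ring k G).
Local Notation t := (edge_gens k G).
Local Notation K := (koszul R n).
Local Notation d := (koszul_diff t).
Local Notation E := (@kmulg k R n).
Local Notation T := (kmulv t).
Implicit Types (x y z : K) (a b c v : 'I_n) (u : 'X_{1..n}) (s : seq 'I_n).

Definition mseq s : 'X_{1..n} := (\sum_(a <- s) U_(a))%MM.

Lemma mseq_cons a s : mseq (a :: s) = (U_(a) + mseq s)%MM.
Proof. exact: big_cons. Qed.

Lemma mseqE s i : mseq s i = count_mem i s.
Proof.
elim: s => [|a s IHs]; first by rewrite /mseq big_nil mnm0E.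
by rewrite mseq_cons mnmDE mnm1E IHs.
Qed.

Lemma mseq_notin s i : i \notin s -> mseq s i = 0%N.
Proof. by rewrite mseqE => /count_memPn. Qed.

Lemma mseq_mem s i : mseq s i != 0%N -> i \in s.
Proof. by apply: contraNT => /mseq_notin->. Qed.

Lemma mdeg_mseq s : mdeg (mseq s) = size s.
Proof.
elim: s => [|a s IHs]; first by rewrite /mseq big_nil mdeg0.
by rewrite mseq_cons mdegD mdeg1 IHs.
Qed.

(** Each vertex is compared with the later ones only, which for symmetric [G] says that [s] induces
    a path in this order. *)
Fixpoint induced_path s : bool :=
  if s is a :: s' then
    all (fun i => (i != a) && (G a i == (ohead s' == Some i))) s' && induced_path s'
  else true.

Lemma induced_path_cons a s :
  induced_path (a :: s) -> mseq s a = 0%N /\ induced_path s.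
Proof.
case/andP=> /allP sa ps; split=> //; apply: mseq_notin; apply/negP => /sa.
by rewrite eqxx.
Qed.

Lemma induced_path_adj a b s : induced_path [:: a, b & s] ->
  G a b /\ nonadjacent G a (mseq s).
Proof.
case/andP=> /allP sa sb; split.
  by have /andP[_ /eqP->] := sa b (mem_head _ _); rewrite /= eqxx.
move=> i /mseq_mem si.
have /andP[_ /eqP->] : (i != a) && (G a i == (Some b == Some i)).
  by apply: sa; rewrite inE si orbT.
apply/negP => /eqP[bi]; have [] := induced_path_cons sb.
by move=> /eqP; rewrite mseqE bi -leqn0 leqNgt -has_count has_pred1 si.
Qed.

Lemma induced_path_uniq s : induced_path s -> uniq s.
Proof.
elim: s => //= a s IHs /andP[/allP sa /IHs ->]; rewrite andbT.
by apply/negP => /sa; rewrite eqxx.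
Qed.

(** The explicit product spanning the homology in multidegree [mseq s]. On a single vertex every
    cycle bounds, hence the value 0, which propagates to all lengths 1 mod 3. *)
Fixpoint path_class s : K :=
  match s with
  | [::] => 1
  | [:: a] => 0
  | [:: a; b] => E a (T b 1)
  | [:: a, b, c & s'] => E a (T b (E c (path_class s')))
  end.

Lemma kdeg_path_class s : kdeg (mseq s) (path_class s).
Proof.
elim/seq_ind3: s => [|a|a b|a b c s IHs]; rewrite ?mseq_cons /=.
- by rewrite /mseq big_nil; apply: kdeg_one.
- exact: kdeg0.
- by apply/kdeg_mulg/kdeg_mulv; rewrite /mseq big_nil; apply: kdeg_one.
- exact/kdeg_mulg/kdeg_mulv/kdeg_mulg.
Qed.

Lemma path_class_eq0 s : size s = 1 %[mod 3] -> path_class s = 0.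
Proof.
elim/seq_ind3: s => [|a|a b|a b c s IHs] //=.
by rewrite -[(size s).+3]addn3 modnDr => /IHs->; rewrite !linear0.
Qed.

Lemma koszul_diff_path a b c x : G a b -> G b c ->
  d (E a (T b (E c x))) = E a (T b (E c (d x))).
Proof.
move=> Gab Gbc; rewrite koszul_diff_mulg kmulv_edge // koszul_diff_mulv.
by rewrite koszul_diff_mulg linearB /= kmulv_edge // !sub0r linearN opprK.
Qed.

Lemma koszul_diff_path_class s : induced_path s -> d (path_class s) = 0.
Proof.
elim/seq_ind3: s => [|a|a b|a b c s IHs] ps.
- exact: koszul_diff1.
- exact: linear0.
- have [Gab _] := induced_path_adj ps.
  by rewrite /= koszul_diff_mulg kmulv_edge // koszul_diff_mulv koszul_diff1
    [T b 0]linear0 [E a 0]linear0 subr0.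
have [Gab _] := induced_path_adj ps; have [_ {}ps] := induced_path_cons ps.
have [Gbc _] := induced_path_adj ps; have [_ {}ps] := induced_path_cons ps.
have [_ {}ps] := induced_path_cons ps.
by rewrite /= koszul_diff_path // IHs // !linear0.
Qed.

(** [kdeg_cycle_leaf3] removes three vertices at a time, down to a constant, an isolated vertex or a
    single edge. *)
Lemma induced_path_cycle s x : induced_path s -> kdeg (mseq s) x -> d x = 0 ->
  exists e y, kdeg (mseq s) y /\ x = e *: path_class s + d y.
Proof.
elim/seq_ind3: s x => [|a|a b|a b c s IHs] x ps; rewrite ?mseq_cons => sx dx.
- move: sx; rewrite /mseq big_nil => /kdeg0P[e ->]; exists e, 0.
  by rewrite linear0 addr0; split=> //; apply: kdeg0.
- have nil_a : nonadjacent G a (mseq [::]) by move=> i; rewrite mseqE.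
  have [q sq ->] := kdeg_cycle_isolated Girr Gsym (or_intror nil_a) sx dx.
  by exists 0, (E a q); rewrite scaler0 add0r; split=> //; apply: kdeg_mulg.
- have [Gab nil_a] := induced_path_adj ps.
  have [sa /induced_path_cons[sb _]] := induced_path_cons ps.
  rewrite mseq_cons in sa.
  have [q [h [sq sh -> _]]] := kdeg_cycle_leaf Girr Gsym Gab nil_a sa sb sx dx.
  move: sh; rewrite /mseq big_nil => /kdeg0P[e ->].
  exists e, (E a q); split; last by rewrite !linearZ addrC.
  by apply: kdeg_mulg; rewrite /mseq big_nil in sq.
have [Gab nac] := induced_path_adj ps; have [sa ps1] := induced_path_cons ps.
have [Gbc nb] := induced_path_adj ps1; have [sb ps2] := induced_path_cons ps1.
have [sc ps3] := induced_path_cons ps2; rewrite !mseq_cons in sa sb nac.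
have [q [h [sq sh dh ->]]] :=
  kdeg_cycle_leaf3 Girr Gsym Gab Gbc nac nb sa sb sc sx dx.
have [e [y [sy ->]]] := IHs h ps3 sh dh.
exists e, (E a q + E a (T b (E c y))); split.
  apply: kdegD; first exact: kdeg_mulg.
  exact/kdeg_mulg/kdeg_mulv/kdeg_mulg.
by rewrite [d (_ + _)]linearD /= koszul_diff_path // !linearP /= [RHS]addrCA.
Qed.

(** [kdeg_boundary_leaf3] reduces to the empty path, where 1 would bound a chain of multidegree 0;
    such a chain involves no e_i. *)
Lemma path_class_nonboundary s x : induced_path s -> size s = 0 %[mod 3] ->
  kdeg (mseq s) x -> path_class s <> d x.
Proof.
elim/seq_ind3: s x => [|a|a b|a b c s IHs] x ps //=; rewrite ?mseq_cons => // size_s sx.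
  move=> /ffunP/(_ set0)/esym/eqP.
  rewrite koszul1E eqxx koszul_diffE big1 ?(eq_sym 0) ?oner_eq0 // => i _.
  by rewrite (kdeg_free (a := i) sx) ?mulr0 ?setU11 ?mseqE.
rewrite /= -[(size s).+3]addn3 modnDr in size_s.
have [Gab nac] := induced_path_adj ps; have [sa ps1] := induced_path_cons ps.
have [Gbc nb] := induced_path_adj ps1; have [sb ps2] := induced_path_cons ps1.
have [sc ps3] := induced_path_cons ps2; rewrite !mseq_cons in sa sb nac.
move=> /= /(kdeg_boundary_leaf3 Girr Gsym Gab Gbc nac nb sa sb sc
  (kdeg_path_class s) sx)[h sh].
exact: IHs.
Qed.

Lemma koszul_bidegree_path_class m s : size s = (3 * m)%N ->
  koszul_bidegree (2 * m) (3 * m) (path_class s).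
Proof.
elim/seq_ind3: s m => [|a|a b|a b c s IHs] [|m] //=; rewrite ?mulnS //.
  by move=> _; apply: koszul_bidegree1.
case=> /IHs ms.
exact/koszul_bidegree_mulg/koszul_bidegree_mulv/koszul_bidegree_mulg.
Qed.

(** e_v is moved past the triples e_a T_b e_c, without sign, to the final edge, where it completes
    the three-vertex path [a], [b], [v]. *)
Lemma class_in_mulg_path_class (P : {pred koszul_homology k G}) s v :
  subalg_closed P ->
  (forall h : koszul_homology k G, homology_bidegree 2 3 h -> h \in P) ->
  induced_path s -> size s = 2 %[mod 3] -> v \notin s -> G (last v s) v ->
  class_in P (E v (path_class s)).
Proof.
move=> Psub P23; elim/seq_ind3: s => [|a|a b|a b c s IHs] // ps.
  move=> _; rewrite !inE negb_or => /andP[va _] /= Gbv.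
  rewrite /= kmulg_anti // -kmulv_mulg -scaleN1r; apply: class_inZ => //.
  apply: class_in_path => //; last exact: class_in_one.
  by have [] := induced_path_adj ps.
rewrite /= -[(size s).+3]addn3 modnDr => size_s.
rewrite !inE !negb_or => /and4P[va vb vc vs] Gsv.
have [Gab _] := induced_path_adj ps; have [_ {}ps] := induced_path_cons ps.
have [Gbc _] := induced_path_adj ps; have [_ {}ps] := induced_path_cons ps.
have [_ {}ps] := induced_path_cons ps.
rewrite kmulg_anti // -kmulv_mulg kmulg_anti // !linearN opprK.
apply: class_in_path => //; apply: IHs => //.
(* The size condition excludes an empty [s], so [last] does not depend on its default. *)
by case: (s) size_s Gsv.
Qed.

End InducedPaths.

(** * Closing a path to a cycle *)

Section ClosedPath.
Variables (k : fieldType) (n : nat) (G : rel 'I_n).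
Hypotheses (Girr : irreflexive G) (Gsym : ssrbool.symmetric G).
Local Notation R := (edge_ring k G).
Local Notation t := (edge_gens k G).
Local Notation K := (koszul R n).
Local Notation d := (koszul_diff t).
Local Notation E := (@kmulg k R n).
Local Notation T := (kmulv t).
Implicit Types (x y z : K).

Variables (v f l : 'I_n) (s : seq 'I_n).
Local Notation fsl := (f :: rcons s l).
Hypotheses (ps : induced_path G s) (pfsl : induced_path G fsl).
Hypotheses (v_notin : v \notin fsl) (Gvf : G v f) (Gvl : G v l).
Hypothesis Gvs : nonadjacent G v (mseq s).

Lemma mseq_rcons (a : 'I_n) (r : seq 'I_n) : mseq (rcons r a) = (U_(a) + mseq r)%MM.
Proof. by rewrite /mseq -cats1 big_cat big_seq1 addmC. Qed.

Lemma koszul_diff_star x :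
  d (T v (E f (E l x))) = T v (E f (E l (d x))).
Proof.
rewrite koszul_diff_mulv koszul_diff_mulg linearB /= kmulv_edge // sub0r.
rewrite koszul_diff_mulg linearB /= linearB /= kmulv_mulg kmulv_edge //.
by rewrite [E f 0]linear0 sub0r opprK.
Qed.

(** Both [f] and [l] are neighbours of [v], so [kmulv_link] at [v] extracts e_f, then e_l; what
    remains lies away from [v], and T_v cancels. *)
Lemma star_cycle z : kdeg (mseq fsl) z -> T v (d z) = 0 ->
  exists h, [/\ kdeg (mseq s) h, d h = 0 & T v z = T v (E f (E l h))].
Proof.
rewrite mseq_cons => zs Tz; have [sf _] := induced_path_cons pfsl.
have [h1 h1s [Th1 /(_ Tz) Tdh1]] := kmulv_link Gvf sf zs.
rewrite mseq_rcons in h1s.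
have sl : mseq s l = 0%N.
  move: (induced_path_uniq pfsl); rewrite /= rcons_uniq => /and3P[_ ls _].
  exact: mseq_notin.
have [h hs [Th /(_ Tdh1) Tdh]] := kmulv_link Gvl sl h1s.
exists h; split=> //; last by rewrite Th1 kmulv_mulg Th !kmulv_mulg.
have vs : mseq s v = 0%N.
  apply: mseq_notin; apply: contra v_notin => vs.
  by rewrite inE mem_rcons inE vs !orbT.
have dhs := kdeg_diff hs.
exact: (kmulv_cancel Girr Gsym dhs (kdeg_free dhs vs) (or_intror Gvs)).
Qed.

Lemma star_cycle_boundary z : size s = 1 %[mod 3] -> kdeg (mseq fsl) z ->
  T v (d z) = 0 -> exists2 y, kdeg (mseq s) y & T v z = d (T v (E f (E l y))).
Proof.
move=> size_s zs /(star_cycle zs)[h [hs dh ->]].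
have [e [y [sy ->]]] := induced_path_cycle Girr Gsym ps hs dh.
exists y => //.
by rewrite (path_class_eq0 k G size_s) scaler0 add0r [RHS]koszul_diff_star.
Qed.

Lemma closed_path_split x : kdeg (mseq (v :: fsl)) x -> d x = 0 ->
  exists e y z, [/\ kdeg (mseq fsl) y, kdeg (mseq fsl) z &
    x = e *: E v (path_class k G fsl) + T v z - d (E v y)].
Proof.
rewrite mseq_cons => xs dx.
have [p [q [ps' qs _ [-> dp _]]]] := kdeg_cycle_split xs dx.
have [e [y [sy ->]]] := induced_path_cycle Girr Gsym pfsl ps' dp.
(* Since [E v (d y) = T v y - d (E v y)], the boundary part of [p] is absorbed into the T_v term. *)
exists e, y, (q + y); split=> //; first exact: kdegD.
rewrite koszul_diff_mulg opprB [E v (_ + _)]linearP [T v (_ + _)]linearD /= -!addrA.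
by rewrite [T v y + _]addrC subrK [T v q + _]addrC.
Qed.

Lemma star_class_in (P : {pred koszul_homology k G}) z : subalg_closed P ->
  (forall h : koszul_homology k G, homology_bidegree 2 3 h -> h \in P) ->
  (forall h, kdeg (mseq s) h -> d h = 0 -> class_in P h) ->
  kdeg (mseq fsl) z -> T v (d z) = 0 -> class_in P (T v z).
Proof.
move=> Psub P23 Ps zs /(star_cycle zs)[h [hs dh ->]].
rewrite kmulv_mulg; apply: class_in_path => //; last exact: Ps.
by rewrite Gsym.
Qed.

Lemma closed_path_class_in (P : {pred koszul_homology k G}) x : subalg_closed P ->
  (forall h : koszul_homology k G, homology_bidegree 2 3 h -> h \in P) ->
  (forall h, kdeg (mseq s) h -> d h = 0 -> class_in P h) ->
  size s != 1 %[mod 3] -> kdeg (mseq (v :: fsl)) x -> d x = 0 -> class_in P x.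
Proof.
move=> Psub P23 Ps size_s xs dx.
have [e [y [z [ys zs xE]]]] := closed_path_split xs dx.
have Pe : class_in P (E v (path_class k G fsl)).
  (* [fsl] is two vertices longer than [s]: residue 0 of [size s] gives 2, where e_v extends the
     last edge, and residue 2 gives 1, where [path_class] is 0. *)
  have := ltn_pmod (size s) (isT : 0 < 3)%N; rewrite -(modn_mod _ 3) in size_s.
  case size_sE: (size s %% 3)%N size_s => [|[|[|//]]] // _ _.
    apply: class_in_mulg_path_class => //; last by rewrite /= last_rcons Gsym.
    by rewrite /= size_rcons -addn2 -modnDml size_sE.
  rewrite path_class_eq0 ?linear0; first exact: class_in0.
  by rewrite /= size_rcons -addn2 -modnDml size_sE.
rewrite xE; apply: class_inD => //; last first.
  by rewrite -scaleN1r; apply: class_inZ => //; apply: class_in_diff.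
apply: class_inD => //; first exact: class_inZ.
apply: star_class_in => //; rewrite -koszul_diff_mulv.
move: dx; rewrite xE linearB /= koszul_diffK subr0 linearD linearZ /=.
by rewrite (class_in_cycle Pe) scaler0 add0r.
Qed.

(** Cycles [T v z] bound here, so the coefficient of [E v (path_class k G fsl)] determines the
    class. It is nonzero for [x1], and a multiple of [x1] cancels it in [x2]. *)
Lemma closed_path_one_dim x1 x2 : size s = 1 %[mod 3] ->
  kdeg (mseq (v :: fsl)) x1 -> d x1 = 0 -> ~ (exists y, x1 = d y) ->
  kdeg (mseq (v :: fsl)) x2 -> d x2 = 0 -> exists e y, x2 = e *: x1 + d y.
Proof.
move=> size_s x1s dx1 x1_nb x2s dx2.
have [e1 [y1 [z1 [y1s z1s x1E]]]] := closed_path_split x1s dx1.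
have [e2 [y2 [z2 [y2s z2s x2E]]]] := closed_path_split x2s dx2.
have Tz_boundary z : kdeg (mseq fsl) z -> d (T v z) = 0 -> exists y, T v z = d y.
  rewrite koszul_diff_mulv => zs /(star_cycle_boundary size_s zs)[y _ ->].
  by exists (T v (E f (E l y))).
have e1_neq0 : e1 != 0.
  apply/eqP => e10; rewrite e10 scale0r add0r in x1E.
  have [|y Ty] := Tz_boundary z1 z1s; last first.
    apply: x1_nb; exists (y - E v y1); rewrite x1E Ty; exact/esym/linearB.
  by move: dx1; rewrite x1E linearB /= koszul_diffK subr0.
pose e := e2 / e1; pose z := z2 - e *: z1.
have zE : T v z = x2 - e *: x1 + d (E v (y2 - e *: y1)).
  rewrite x1E x2E scalerBr scalerDr scalerA divfK // [E v (_ - _)]linearB /=.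
  rewrite [d (_ - _)]linearB [E v (_ *: _)]linearZ /= [d (_ *: _)]linearZ /=.
  rewrite [T v (_ - _)]linearB /= [T v (_ *: _)]linearZ /= -/e.
  move: (e2 *: E v _) => w.
  by rewrite opprB -addrA [_ - _ + (_ - _)]addrC !subrKA opprD addrACA subrr add0r.
have [||y Ty] := Tz_boundary z.
- by apply: kdegB => //; apply: kdegZ.
- by rewrite zE linearD linearB linearZ /= dx1 dx2 koszul_diffK scaler0 subr0 addr0.
exists e, (y - E v (y2 - e *: y1)).
by rewrite linearB /= -Ty zE addrK addrCA subrr addr0.
Qed.

(** The obstruction [d (E v w) = T v w], with [w] the path class, is itself [d (T v (E f (E l y)))];
    subtracting that chain corrects [E v w] to a cycle. *)
Lemma closed_path_exotic : size s = 1 %[mod 3] -> exists2 z, kdeg (mseq fsl) z &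
  d (E v (path_class k G fsl) + T v z) = 0.
Proof.
move=> size_s; have fs := kdeg_path_class k G fsl.
have dfsl := koszul_diff_path_class k pfsl.
have [|y ys Ty] := star_cycle_boundary size_s fs.
  by rewrite dfsl linear0.
exists (- E f (E l y)).
  by apply: kdegN; rewrite mseq_cons mseq_rcons; do 2 apply: kdeg_mulg.
rewrite linearD /= koszul_diff_mulg dfsl linear0 subr0 [T v (- _)]linearN linearN /=.
by rewrite Ty subrr.
Qed.

End ClosedPath.

(** * The slope filtration *)

Section SlopeFiltration.
Variables (k : fieldType) (n : nat) (G : rel 'I_n).
Local Notation R := (edge_ring k G).
Local Notation t := (edge_gens k G).
Local Notation K := (koszul R n).
Local Notation d := (koszul_diff t).
Local Notation E := (@kmulg k R n).
Local Notation T := (kmulv t).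
Implicit Types (x y : K) (A B : {set 'I_n}) (r : R) (u : 'X_{1..n}).

(** Degree at least e / 2, doubled to stay in the natural numbers. A bound on one lift suffices, as
    membership is only used to bound coefficients of independent monomials. *)
Definition min_degree2 e r : Prop :=
  exists2 p, forall m, m \in msupp p -> (e <= 2 * mdeg m)%N & r = edge_pi G p.

Lemma min_degree20 e : min_degree2 e 0.
Proof. by exists 0; rewrite ?rmorph0 // => m; rewrite msupp0. Qed.

Lemma min_degree2D e r1 r2 :
  min_degree2 e r1 -> min_degree2 e r2 -> min_degree2 e (r1 + r2).
Proof.
case=> p pe -> [q qe ->]; exists (p + q); last by rewrite rmorphD.
by move=> m /msuppD_le; rewrite mem_cat => /orP[/pe|/qe].
Qed.

Lemma min_degree2Z e (c : k) r : min_degree2 e r -> min_degree2 e (c *: r).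
Proof.
case=> p pe ->; exists (c *: p); last by rewrite edge_piZ.
by move=> m /msuppZ_le /pe.
Qed.

Lemma min_degree2M e1 e2 r1 r2 :
  min_degree2 e1 r1 -> min_degree2 e2 r2 -> min_degree2 (e1 + e2) (r1 * r2).
Proof.
case=> p pe -> [q qe ->]; exists (p * q); last by rewrite rmorphM.
move=> m /msuppM_le /allpairsP[[m1 m2] /= [/pe le1 /qe le2 ->]].
by rewrite mdegD mulnDr leq_add.
Qed.

(* As an edge has bidegree (1, 2) and a path on three vertices (2, 3), products
   of these live in bidegrees (i, j) with 3 i <= 2 j, that is, with coefficients
   of degree at least i / 2. *)
Definition low_slope x : Prop := forall A, min_degree2 #|A| (x A).

Lemma low_slope1 : low_slope 1.
Proof.
move=> A; rewrite koszul1E; have [->|_] := eqVneq A set0; last exact: min_degree20.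
by rewrite cards0; exists 1; rewrite ?rmorph1.
Qed.

Lemma low_slope_lin (c : k) x y : low_slope x -> low_slope y -> low_slope (c *: x + y).
Proof.
move=> lx ly A; rewrite koszulDE koszulZE.
by apply: min_degree2D => //; apply: min_degree2Z.
Qed.

Lemma low_slopeM x y : low_slope x -> low_slope y -> low_slope (x * y).
Proof.
move=> lx ly A; rewrite koszulME.
apply: (big_ind (min_degree2 #|A|)) => [||B BA].
- exact: min_degree20.
- exact: min_degree2D.
rewrite -(cardsID B A) (setIidPr BA); apply: min_degree2M => //.
rewrite -[x B]scale1r signr_mulZ; exact: min_degree2Z.
Qed.

Lemma low_slope_bidegree i j x :
  (3 * i <= 2 * j)%N -> koszul_bidegree i j x -> low_slope x.
Proof.
move=> le_ij xij A; have [->|xA] := eqVneq (x A) 0; first exact: min_degree20.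
have [-> [e eE [p pe ->]]] := xij A xA; exists p => // m.
move: pe => /dhomogP pe /pe /= ->.
by rewrite -(leq_add2r (2 * i)) -mulnDr eE -mulSn.
Qed.

Lemma mdeg_mset A : mdeg (mset A) = #|A|.
Proof.
rewrite mdegE -sum1_card [RHS]big_mkcond; apply: eq_bigr => i _.
by rewrite msetE; case: (i \in A).
Qed.

Lemma kproj_coeff0 u x A p : x A = edge_pi G p ->
  (forall m, u = (mset A + m)%MM -> p@_m = 0) -> kproj u x A = 0.
Proof.
move=> xA p0; rewrite ffunE; case: ifP => // uA.
by rewrite xA edge_coeff_pi p0 ?scale0r // addmC submK.
Qed.

(** The coefficient at [A] in multidegree [u] has degree [mdeg u - #|A|], here below half of
    [#|A|]. *)
Lemma kproj_low_slope u x A : low_slope x -> (2 * mdeg u < 3 * #|A|)%N ->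
  kproj u x A = 0.
Proof.
move=> lx lt_uA; have [p pA xA] := lx A; apply: (kproj_coeff0 xA) => m uE.
apply/eqP; rewrite mcoeff_eq0; apply/negP => /pA; apply/negP; rewrite -ltnNge.
by move: lt_uA; rewrite uE mdegD mdeg_mset mulnDr mulSn addnC ltn_add2r.
Qed.

Lemma kproj_bidegree i j u x : koszul_bidegree i j x -> mdeg u != j -> kproj u x = 0.
Proof.
move=> xij uj; apply/ffunP => A; rewrite [RHS]ffunE.
have [x0|xA] := eqVneq (x A) 0.
  by apply: (@kproj_coeff0 u x A 0) => [|m _]; rewrite ?mcoeff0 ?rmorph0.
have [<- [e eE [p pe xE]]] := xij A xA; apply: (kproj_coeff0 xE) => m uE.
apply: (dhomog_nemf_coeff pe) => /=; apply: contra uj => /eqP me.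
by rewrite uE mdegD mdeg_mset me addnC eE.
Qed.

Definition hproj i x : K := [ffun A : {set 'I_n} => if #|A| == i then x A else 0].

Lemma hprojE i x A : hproj i x A = if #|A| == i then x A else 0.
Proof. exact: ffunE. Qed.

Lemma hproj_is_linear i : linear (hproj i).
Proof.
move=> c x y; apply/ffunP => A; rewrite !(hprojE, koszulDE, koszulZE).
by case: ifP; rewrite ?scaler0 ?addr0.
Qed.
HB.instance Definition _ i :=
  GRing.isLinear.Build k K K *:%R (hproj i) (hproj_is_linear i).

Lemma kdeg_hproj u i x : kdeg u x -> kdeg u (hproj i x).
Proof. by move=> ux A; rewrite hprojE; case: ifP => _; [apply: ux | left]. Qed.

Lemma hproj_mulv i a x : hproj i (T a x) = T a (hproj i x).
Proof.
by apply/ffunP => A; rewrite !(hprojE, kmulvE); case: ifP; rewrite ?mulr0.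
Qed.

Lemma hproj_mulg i a x : hproj i.+1 (E a x) = E a (hproj i x).
Proof.
apply/ffunP => A; rewrite !(hprojE, kmulgE); case: ifP; last first.
  by case: ifP => // aA; rewrite (cardsD1 a A) aA eqSS => ->; rewrite mulr0.
by case: ifP => // aA; rewrite (cardsD1 a A) aA eqSS => ->.
Qed.

Lemma koszul_diff_hproj i x : d (hproj i.+1 x) = hproj i (d x).
Proof.
apply/ffunP => A; rewrite hprojE !koszul_diffE.
case: eqP => [<-|/eqP/negPf Ai].
  by apply: eq_bigr => j jA; rewrite hprojE cardsU1 jA eqxx.
by rewrite big1 // => j jA; rewrite hprojE cardsU1 jA eqSS Ai mulr0.
Qed.

Lemma hproj_bidegree i j x : koszul_bidegree i j x -> hproj i x = x.
Proof.
move=> xij; apply/ffunP => A; rewrite hprojE; case: eqP => // Ai.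
by have [->//|/xij[/Ai]] := eqVneq (x A) 0.
Qed.

(** Only some representative is constrained, since adding a boundary can break the slope bound. *)
Definition low_slope_class : {pred koszul_homology k G} := fun h =>
  `[< exists2 z : koszul_cycle t, low_slope (val z) & h = homology_class z >].

Lemma low_slope_class_subalg : subalg_closed low_slope_class.
Proof.
split; first by apply/asboolP; exists 1; rewrite ?rmorph1 //; apply: low_slope1.
- move=> c _ _ /asboolP[z lz ->] /asboolP[w lw ->]; apply/asboolP.
  exists (c *: z + w); last by rewrite [RHS]linearP.
  by rewrite linearP; apply: low_slope_lin.
- move=> _ _ /asboolP[z lz ->] /asboolP[w lw ->]; apply/asboolP.
  exists (z * w); last by rewrite rmorphM.
  by rewrite rmorphM; apply: low_slopeM.
Qed.

Lemma low_slope_class_bidegree i j h : (3 * i <= 2 * j)%N ->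
  homology_bidegree i j h -> h \in low_slope_class.
Proof.
move=> le_ij [z zij ->]; apply/asboolP; exists z => //.
exact: low_slope_bidegree zij.
Qed.

End SlopeFiltration.

(** If the generators sufficed, the exotic cycle would be a low-slope cycle plus a boundary. In its
    leading bidegree the low-slope part vanishes, which would make the path class on [fsl] a
    boundary. *)
Lemma closed_path_not_generated (k : fieldType) (n : nat) (G : rel 'I_n)
    (v f l : 'I_n) (s : seq 'I_n) :
  irreflexive G -> ssrbool.symmetric G ->
  induced_path G s -> induced_path G (f :: rcons s l) ->
  v \notin f :: rcons s l -> G v f -> G v l -> nonadjacent G v (mseq s) ->
  size s = 1 %[mod 3] ->
  ~ generates_algebra (A := koszul_homology k G)
      (fun h => homology_bidegree 1 2 h \/ homology_bidegree 2 3 h).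
Proof.
move=> Girr Gsym ps pfsl v_fsl Gvf Gvl Gvs size_s gen.
set fsl := f :: rcons s l in pfsl v_fsl.
have [z zs dz] := closed_path_exotic k Girr Gsym ps pfsl v_fsl Gvf Gvl Gvs size_s.
set zeta := _ + _ in dz.
have zeta_cycle : zeta \in koszul_cycles (edge_gens k G) by rewrite unfold_in dz.
have : homology_class (KoszulCycle zeta_cycle) \in @low_slope_class k n G.
  apply: gen => [|h []]; first exact: low_slope_class_subalg.
    exact: low_slope_class_bidegree.
  exact: low_slope_class_bidegree.
case/asboolP=> g lg /homology_class_eq/asboolP[w]; rewrite rmorphB /= => gw.
have zetaE : zeta = val g + koszul_diff (edge_gens k G) w by rewrite -gw addrC subrK.
have [m size_fsl] : exists m, size fsl = (3 * m)%N.
  exists (size s %/ 3).+1; rewrite /= size_rcons {1}(divn_eq (size s) 3) size_s.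
  by rewrite modn_small //; lia.
pose u := mseq (v :: fsl).
have vu : (U_(v) + mseq fsl)%MM = u by rewrite -mseq_cons.
have zeta_u : kdeg u zeta.
  by rewrite -vu; apply: kdegD; [apply/kdeg_mulg/kdeg_path_class | apply: kdeg_mulv].
(* The slope bound fails here: 2 (3m + 1) < 3 (2m + 1). *)
have g0 : hproj (2 * m).+1 (kproj u (val g)) = 0.
  apply/ffunP => A; rewrite hprojE [RHS]ffunE; case: eqP => // cardA.
  apply: kproj_low_slope => //; rewrite cardA.
  by rewrite /u mdeg_mseq (_ : size (v :: fsl) = (3 * m).+1) -?size_fsl //; lia.
pose W := hproj (2 * m).+2 (kproj u w).
have : hproj (2 * m).+1 zeta = koszul_diff (edge_gens k G) W.
  rewrite -{1}(_ : kproj u zeta = zeta); last by rewrite (kproj_kdeg _ zeta_u) eqxx.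
  by rewrite zetaE !linearD /= g0 add0r -koszul_diff_kproj -koszul_diff_hproj.
have : kdeg (U_(v) + mseq fsl)%MM W.
  by rewrite vu; apply: kdeg_hproj; apply: kdeg_kproj.
(* Comparing the e_v parts of both sides will give [path_class k G fsl = d (- p)]. *)
case/kdeg_split=> p [q [up uq fp fq ->]].
rewrite koszul_diff_split linearD /= hproj_mulg hproj_mulv.
rewrite (hproj_bidegree (koszul_bidegree_path_class size_fsl)).
move=> eqE.
have vfsl : mseq fsl v = 0%N by apply: mseq_notin.
pose y := path_class k G fsl + koszul_diff (edge_gens k G) p.
pose y' := hproj (2 * m).+1 z - (p + koszul_diff (edge_gens k G) q).
have fy : gen_free v y.
  apply: gen_freeD; last exact: gen_free_diff.
  exact: (kdeg_free (kdeg_path_class k G fsl) vfsl).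
have fy' : gen_free v y'.
  have zm := kdeg_hproj (2 * m).+1 zs.
  by apply: (kdeg_free _ vfsl); apply: kdegB zm _; apply: kdegD up (kdeg_diff uq).
have [y0 _] : y = 0 /\ kmulv (edge_gens k G) v y' = 0.
  apply: kmulgv_eq0 => //; rewrite /y /y' [kmulg v _]linearD [kmulv _ v _]linearB /=.
  by rewrite addrACA eqE [kmulg v (- _)]linearN /= addrACA addNr subrr addr0.
have size_fsl0 : size fsl = 0 %[mod 3] by rewrite size_fsl modnMr.
apply: (path_class_nonboundary Girr Gsym pfsl size_fsl0 (kdegN up)).
by apply/eqP; rewrite linearN -addr_eq0 -/y y0.
Qed.

(** * Path graphs and cycle graphs *)

Section Assembly.
Variables (k : fieldType) (n : nat) (G : rel 'I_n).
Local Notation t := (edge_gens k G).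
Local Notation K := (koszul (edge_ring k G) n).
Local Notation d := (koszul_diff t).
Implicit Types (x y : K) (u : 'X_{1..n}).

Lemma koszul_cycle_sum x : d x = 0 -> exists s : seq 'X_{1..n},
  [/\ uniq s, x = \sum_(u <- s) kproj u x & forall u, d (kproj u x) = 0].
Proof.
move=> dx; have [s sP] := koszul_sum_kdeg x.
exists (undup s); split; first exact: undup_uniq.
  by apply: sP => [|u]; rewrite ?undup_uniq ?mem_undup.
by move=> u; rewrite koszul_diff_kproj dx linear0.
Qed.

Lemma generated_by_multigraded (P : {pred koszul_homology k G}) : subalg_closed P ->
  (forall u x, kdeg u x -> d x = 0 -> class_in P x) -> forall h, h \in P.
Proof.
move=> Psub Pu h; rewrite -(homology_reprK h); set z := homology_repr h.
have [s [_ zE dz]] := koszul_cycle_sum (koszul_cycleE z).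
suff [z' /val_inj <-] : class_in P (val z) by [].
rewrite zE; apply: (big_ind (class_in P)) => [||u _]; first exact: class_in0.
  by move=> x y; apply: class_inD.
by apply: Pu (kdeg_kproj u _) _.
Qed.

(** Components of total degree other than [j] vanish, and those with an entry above 1 bound; only
    [u0] is left. *)
Lemma homology_multidegree j u0 (z : koszul_cycle t) i : irreflexive G ->
  ssrbool.symmetric G -> koszul_bidegree i j (val z) ->
  (forall u, mdeg u = j -> u != u0 -> exists a, (1 < u a)%N) ->
  exists y, val z = kproj u0 (val z) + d y.
Proof.
move=> Girr Gsym zij ju; have [s [us zE dz]] := koszul_cycle_sum (koszul_cycleE z).
pose D x := exists y, x = d y.
have Dsum (r : seq _) (Q : pred _) : (forall u, Q u -> u != u0) ->
    D (\sum_(u <- r | Q u) kproj u (val z)).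
  move=> Qu0; apply: (big_ind D) => [|_ _ [y ->] [y' ->]|u /Qu0 uu0].
  - by exists 0; rewrite linear0.
  - by exists (y + y'); rewrite linearD.
  have [uj|uj] := eqVneq (mdeg u) j; last first.
    by exists 0; rewrite linear0 (kproj_bidegree zij).
  have [a ua] := ju u uj uu0.
  have [y yE] := kdeg_cycle_square Girr Gsym ua (kdeg_kproj u (val z)) (dz u).
  by exists y.
have [u0s|u0s] := boolP (u0 \in s).
  have [y Dy] := Dsum s (fun u => u != u0) (fun u => id).
  by exists y; rewrite {1}zE (bigD1_seq u0) //= Dy.
have z0 : kproj u0 (val z) = 0.
  rewrite zE linear_sum big1_seq //= => u uins.
  rewrite (kproj_kdeg _ (kdeg_kproj u _)); case: eqP u0s => // <-.
  by rewrite uins.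
have [|y Dy] := Dsum s (fun u => u \in s).
  by move=> u uins; apply: contraNneq u0s => <-.
by exists y; rewrite z0 add0r {1}zE big_seq Dy.
Qed.

End Assembly.

Lemma path_graph_sym n : ssrbool.symmetric (path_graph n).
Proof. by move=> i j; rewrite /path_graph orbC. Qed.

Lemma path_graph_irr n : irreflexive (path_graph n).
Proof. by move=> i; rewrite /path_graph !(gtn_eqF (ltnSn _)). Qed.

Lemma cycle_graph_sym n : ssrbool.symmetric (cycle_graph n).
Proof. by move=> i j; rewrite /cycle_graph orbC. Qed.

Lemma cycle_graph_irr n : (1 < n)%N -> irreflexive (cycle_graph n).
Proof.
move=> n_gt1 i; rewrite /cycle_graph orbb; apply/negP => /eqP/(congr1 val) /=.
have [in1|] := ltnP i.+1 n; first by rewrite modn_small //; lia.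
move=> ni; have -> : i.+1 = n by apply/eqP; rewrite eqn_leq ni ltn_ord.
by rewrite modnn; have := ltn_ord i; lia.
Qed.

Lemma mnm_neq0 n (u : 'X_{1..n}) : u != 0%MM -> exists a, u a != 0%N.
Proof.
move=> u0; have [/existsP //|] := boolP [exists a, u a != 0%N].
rewrite negb_exists => /forallP u0'; case/negP: u0; apply/eqP/mnmP => i.
by rewrite mnm0E; apply/eqP; have := u0' i; rewrite negbK.
Qed.

Lemma path_graph_leaf n (u : 'X_{1..n}) : u != 0%MM -> exists a b c,
  [/\ u a != 0%N, forall i, u i != 0%N -> path_graph n a i -> i = b
    & forall i, u i != 0%N -> path_graph n b i -> i = a \/ i = c].
Proof.
case/mnm_neq0=> a0 ua0.
case: (@arg_minnP _ a0 (fun a => u a != 0%N) val ua0) => a ua a_min.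
exists a, (ordS a), (ordS (ordS a)); split=> // i ui /orP[] /eqP ai.
- by apply/val_inj; rewrite /= ai modn_small.
- by have := a_min i ui; rewrite /= -ai ltnn.
- by right; apply/val_inj; rewrite /= -ai modn_small // ai.
(* If [ordS a] wraps around to 0, no vertex has it as its successor in the path. *)
- left; apply/val_inj => /=; move: ai => /=.
  have [a_lt|a_ge] := ltnP a.+1 n; first by rewrite modn_small // => -[].
  have -> : a.+1 = n by apply/eqP; rewrite eqn_leq a_ge ltn_ord.
  by rewrite modnn.
Qed.

Lemma iter_ordS n (i : 'I_n) m : val (iter m (@ordS n) i) = ((i + m) %% n)%N.
Proof.
elim: m => [|m IHm]; first by rewrite addn0 modn_small.
by rewrite iterS /= IHm -addn1 modnDml addn1 addnS.
Qed.

(** Going round the cycle, some vertex outside the support is followed by one inside, which serves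
    as [a]. Otherwise the zero at [v] would spread to every vertex. *)
Lemma cycle_graph_leaf n (u : 'X_{1..n}) v : u v = 0%N -> u != 0%MM -> exists a b c,
  [/\ u a != 0%N, forall i, u i != 0%N -> cycle_graph n a i -> i = b
    & forall i, u i != 0%N -> cycle_graph n b i -> i = a \/ i = c].
Proof.
move=> uv u0; have [i ui uSi] : exists2 i, u i = 0%N & u (ordS i) != 0%N.
  have [/exists_inP[i /eqP]|] := boolP [exists (i | u i == 0%N), u (ordS i) != 0%N].
    by exists i.
  rewrite negb_exists => /forallP H; have {}H i : u i = 0%N -> u (ordS i) = 0%N.
    by move=> ui; have := H i; rewrite ui eqxx /= negbK => /eqP.
  have [j /negP[]] := mnm_neq0 u0; apply/eqP.
  have -> : j = iter (j + n - v) (@ordS n) v.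
    apply/val_inj; rewrite iter_ordS.
    have -> : (v + (j + n - v) = j + n)%N by have := ltn_ord v; lia.
    by rewrite modnDr modn_small.
  by elim: (j + n - v)%N => //= m; apply: H.
exists (ordS i), (ordS (ordS i)), (ordS (ordS (ordS i))); split=> // j uj /orP[] /eqP.
- by move=> <-.
- by move/ordS_inj => ji; rewrite ji ui in uj.
- by move=> <-; right.
- by move/ordS_inj; left.
Qed.

Definition segment N j len : seq 'I_N.+1 := [seq inord i | i <- iota j len].

Lemma segment_mem N j len i : (j + len <= N.+1)%N ->
  (i \in segment N j len) = (j <= i < j + len)%N.
Proof.
move=> le_N; apply/mapP/idP => [[m]|lt_i].
  by rewrite mem_iota => jm ->; rewrite inordK //; lia.
by exists (val i); rewrite ?mem_iota // inord_val.
Qed.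

(** The bound keeps the last vertex [N] out of the segment, so no successor wraps around. *)
Lemma segment_induced_path N j len : (j + len <= N)%N ->
  induced_path (cycle_graph N.+1) (segment N j len).
Proof.
elim: len j => //= len IHlen j le_N; apply/andP; split; last by apply: IHlen; lia.
apply/allP => i; rewrite segment_mem => [lt_i|]; last by lia.
rewrite /cycle_graph -!val_eqE /= inordK; last by lia.
rewrite !modn_small; [|lia|lia].
have -> : (ohead [seq inord i | i <- iota j.+1 len] == Some i) = (j.+1 == i).
  case: len le_N lt_i {IHlen} => [|len] /= le_N lt_i; first by lia.
  by rewrite (inj_eq Some_inj) -val_eqE /= inordK //; lia.
by apply/andP; split; [lia | apply/eqP; lia].
Qed.

Lemma mnm_trichotomy n (u u1 : 'X_{1..n}) : (forall i, u1 i = 1%N) ->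
  [\/ exists i, u i = 0%N, exists i, (1 < u i)%N | u = u1].
Proof.
move=> u1E; have [/existsP[i /eqP]|] := boolP [exists i, u i == 0%N].
  by constructor 1; exists i.
rewrite negb_exists => /forallP u_neq0.
have [/existsP|] := boolP [exists i, (1 < u i)%N]; first by constructor 2.
rewrite negb_exists => /forallP u_le1; constructor 3; apply/mnmP => i.
by have := u_neq0 i; have := u_le1 i; rewrite u1E; lia.
Qed.

Lemma cycle_graph_unroll M : exists f l s, let fsl := f :: rcons s l in
  [/\ [/\ size s = M, induced_path (cycle_graph M.+3) s,
          induced_path (cycle_graph M.+3) fsl & ord_max \notin fsl],
      cycle_graph M.+3 ord_max f, cycle_graph M.+3 ord_max l,
      nonadjacent (cycle_graph M.+3) ord_max (mseq s)
    & forall i, mseq (ord_max :: fsl) i = 1%N].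
Proof.
(* Removing the vertex M + 2 leaves the path 0, ..., M + 1, whose two ends are the neighbours of the
   removed vertex. *)
exists (inord 0), (inord M.+1), (segment M.+2 1 M).
have -> : inord 0 :: rcons (segment M.+2 1 M) (inord M.+1) = segment M.+2 0 M.+2.
  have iota_rcons : rcons (iota 1 M) M.+1 = iota 1 M.+1.
    by rewrite -[M.+1 in RHS]addn1 iotaD cats1 add1n.
  by rewrite /segment -[rcons _ _]map_rcons iota_rcons.
have max_notin : ord_max \notin segment M.+2 0 M.+2 by rewrite segment_mem //= ltnn.
have psegment : induced_path (cycle_graph M.+3) (segment M.+2 0 M.+2).
  exact: segment_induced_path.
split=> [|||i /mseq_mem|i].
- by split=> //; [rewrite size_map size_iota | apply: segment_induced_path].
- by apply/orP; left; rewrite -val_eqE /= inordK // modnn.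
- by apply/orP; right; rewrite -val_eqE /= inordK // modn_small.
- rewrite segment_mem; last by lia.
  move=> lt_i; rewrite /cycle_graph -!val_eqE /= modnn modn_small; last by lia.
  by apply/negP; lia.
have uniq_all : uniq (ord_max :: segment M.+2 0 M.+2).
  by rewrite cons_uniq max_notin (induced_path_uniq psegment).
rewrite mseqE count_uniq_mem // (_ : i \in _) // inE segment_mem // -val_eqE /=.
by have := ltn_ord i; lia.
Qed.

Lemma cycle_graph_class_in (k : fieldType) (n : nat)
    (P : {pred koszul_homology k (cycle_graph n)}) (u : 'X_{1..n}) v x :
  (1 < n)%N -> subalg_closed P ->
  (forall h : koszul_homology k (cycle_graph n), homology_bidegree 1 2 h -> h \in P) ->
  (forall h : koszul_homology k (cycle_graph n), homology_bidegree 2 3 h -> h \in P) ->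
  u v = 0%N -> kdeg u x -> koszul_diff (edge_gens k (cycle_graph n)) x = 0 ->
  class_in P x.
Proof.
move=> n_gt1 Psub P12 P23 uv.
apply: (class_in_forest Psub P12 P23 (F := fun u => u v = 0%N)) => //.
- exact: cycle_graph_irr.
- exact: cycle_graph_sym.
- by move=> u1 u2; rewrite mnmDE; lia.
- by move=> u1; apply: cycle_graph_leaf.
Qed.

Theorem theorem3p15 (k : fieldType) (n : nat) (n_ge3 : (3 <= n)%N) :
  generates_algebra (A := koszul_homology k (path_graph n))
    (fun h => homology_bidegree 1 2 h \/ homology_bidegree 2 3 h)
  /\
  (generates_algebra (A := koszul_homology k (cycle_graph n))
     (fun h => homology_bidegree 1 2 h \/ homology_bidegree 2 3 h)
   <-> n != 1 %[mod 3])
  /\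
  (n = 1 %[mod 3] ->
   forall z : koszul_homology k (cycle_graph n),
     z != 0 -> homology_bidegree (ceil_divn (2 * n) 3) n z ->
     generates_algebra (A := koszul_homology k (cycle_graph n))
       (fun h => [\/ homology_bidegree 1 2 h, homology_bidegree 2 3 h | h = z])).
Proof.
split.
  move=> P Psub Pgens; apply: generated_by_multigraded => // u x.
  apply: (class_in_forest Psub _ _ (F := fun=> True)) => //.
  - by move=> h h12; apply: Pgens; left.
  - by move=> h h23; apply: Pgens; right.
  - exact: path_graph_irr.
  - exact: path_graph_sym.
  - by move=> u1 _; apply: path_graph_leaf.
have n_gt1 : (1 < n)%N by lia.
have Girr := cycle_graph_irr n_gt1; have Gsym := @cycle_graph_sym n.
case: n n_ge3 n_gt1 Girr Gsym => [|[|[|M]]] // _ n_gt1 Girr Gsym.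
have [f [l [s [[size_s ps pfsl v_fsl] Gvf Gvl Gvs u1E]]]] := cycle_graph_unroll M.
set v := ord_max in v_fsl Gvf Gvl Gvs u1E; set u1 := mseq _ in u1E.
have sM : (size s = 1 %[mod 3]) <-> (M.+3 = 1 %[mod 3]).
  by rewrite size_s -[M.+3]addn3 modnDr.
have vs : mseq s v = 0%N.
  apply: mseq_notin; apply: contra v_fsl => vs.
  by rewrite inE mem_rcons inE vs !orbT.
split; [split=> [gen|n_neq1]|].
- apply/eqP => /sM size_s1.
  exact: (closed_path_not_generated Girr Gsym ps pfsl v_fsl Gvf Gvl Gvs size_s1 gen).
- move=> P Psub Pgens; apply: generated_by_multigraded => // u x ux dx.
  have P12 h : homology_bidegree 1 2 h -> h \in P by move=> ?; apply: Pgens; left.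
  have P23 h : homology_bidegree 2 3 h -> h \in P by move=> ?; apply: Pgens; right.
  have [[i ui]|[i ui]|uE] := mnm_trichotomy u u1E.
  + exact: cycle_graph_class_in ui ux dx.
  + by have [y ->] := kdeg_cycle_square Girr Gsym ui ux dx; apply: class_in_diff.
  rewrite uE in ux.
  apply: (closed_path_class_in Girr Gsym pfsl v_fsl Gvf Gvl Gvs Psub P23 _ _ ux dx).
    by move=> h hs dh; apply: cycle_graph_class_in vs hs dh.
  by apply: contra n_neq1 => /eqP/sM/eqP.
move=> /sM size_s1 zeta zeta_neq0 [z zij zetaE] P Psub Pgens.
have P12 h : homology_bidegree 1 2 h -> h \in P.
  by move=> ?; apply: Pgens; constructor 1.
have P23 h : homology_bidegree 2 3 h -> h \in P.
  by move=> ?; apply: Pgens; constructor 2.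
have [|y zE] := homology_multidegree (u0 := u1) Girr Gsym zij.
  move=> u uM uu1; have [[i ui]|//|uE] := mnm_trichotomy u u1E; last first.
    by rewrite uE eqxx in uu1.
  (* Pigeonhole: with one zero entry and all others at most 1, the total degree would be less than
     n. *)
  have [//|/forallNP u_le1] := pselect (exists a, (1 < u a)%N).
  have : (\sum_(j | j != i) u j <= \sum_(j : 'I_M.+3 | j != i) 1)%N.
    by apply: leq_sum => j _; rewrite leqNgt; apply/negP.
  rewrite sum1_card cardC1 card_ord; move: uM.
  by rewrite mdegE (bigD1 i) //= ui add0n => ->; rewrite ltnn.
have dz1 : koszul_diff (edge_gens k (cycle_graph M.+3)) (kproj u1 (val z)) = 0.
  by rewrite koszul_diff_kproj koszul_cycleE linear0.
(* The projection differs from the representative by a boundary, so if it bounded, the given class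
   would be 0. *)
have z1_nb : ~ exists y,
    kproj u1 (val z) = koszul_diff (edge_gens k (cycle_graph M.+3)) y.
  case=> y' y'E; case/negP: zeta_neq0; rewrite zetaE homology_class_eq0.
  by apply/asboolP; exists (y' + y); rewrite linearD /= -y'E.
have Pz : class_in P (kproj u1 (val z)).
  rewrite -[kproj u1 _](addrK (koszul_diff (edge_gens k (cycle_graph M.+3)) y)) -zE.
  apply: class_inD => //.
    by exists z => //; apply: Pgens; constructor 3.
  by rewrite -linearN; apply: class_in_diff.
apply: generated_by_multigraded => // u x ux dx.
have [[i ui]|[i ui]|uE] := mnm_trichotomy u u1E.
- exact: cycle_graph_class_in ui ux dx.
- by have [y' ->] := kdeg_cycle_square Girr Gsym ui ux dx; apply: class_in_diff.
rewrite uE in ux.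
have [e [y' ->]] := closed_path_one_dim Girr Gsym ps pfsl v_fsl Gvf Gvl Gvs size_s1
  (kdeg_kproj u1 (val z)) dz1 z1_nb ux dx.
by apply: class_inD => //; [apply: class_inZ | apply: class_in_diff].
Qed.
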